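(* (Conjecture.) Suppose $\Lambda=K\Gamma/I$ is a triangular algebra with Jacobson radical $J$, and $U$ is a uniserial $\Lambda$-module with mast $p=\alpha_{n-1}\cdots\alpha_1$, where $\alpha_i\colon i\to i+1$. Then the following statements are equivalent: (1) The embedding $JU\to U$ is irreducible. (2) $U$ is not simple and satisfies both (a) and (b) below: (a) For every $\beta\in B$, $\ \beta\alpha_{\mathrm{s}(\beta)-1}\cdots\alpha_1\in Jp$; and for every $\delta\in D$, $\ \delta\alpha_{\mathrm{s}(\delta)-1}\cdots\alpha_1\in K\,\alpha_{\mathrm{t}(\delta)-1}\cdots\alpha_1$. (b) There exists a subset $R\subset J$ such that $\{rp+J^2p\mid r\in R\}$ forms a $K$-basis for $Jp/J^2p$ and (i) and (ii) both hold: (i) For every $\gamma\in C$ there exists $w\in pJ$ such that, for every $r\in R$, $\ r\alpha_{n-1}\cdots\alpha_{\mathrm{t}(\gamma)}\gamma=rw$. (ii) For every $\delta\in D$ and every $r\in R$, $\ r\alpha_{n-1}\cdots\alpha_{\mathrm{t}(\delta)}\delta\in K\,r\alpha_{n-1}\cdots\alpha_{\mathrm{s}(\delta)}$.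
   Context: $K$ is a field, $\Gamma$ a finite quiver with vertex set $\Gamma_0$ and arrow set $\Gamma_1$, $I$ an admissible ideal of the path algebra $K\Gamma$, and $\Lambda=K\Gamma/I$ is finite-dimensional; modules are finitely generated left modules. Paths and maps are composed from right to left; $\mathrm{s}(q)$ and $\mathrm{t}(q)$ are the starting and end points of a path $q$. Vertices and paths are identified with their classes in $\Lambda$ where useful. $\Lambda$ is triangular if $\Gamma$ has no directed cycles. A module is uniserial if it has only one composition series with simple factors. If $U$ is uniserial of length $n$, a mast of $U$ is a path $p$ in $\Gamma$ of length $n-1$ such that $px\neq0$ for some $x\in U$. The vertices passed by $p$ are named $1,\dots,n$, so $p=1\xrightarrow{\alpha_1}2\xrightarrow{\alpha_2}\cdots\xrightarrow{\alpha_{n-1}}n$. An expression $\alpha_i\cdots\alpha_j$ with $i<j$ stands for $1$. Define $B=\{\beta\in\Gamma_1\mid \mathrm{s}(\beta)\in\{1,\dots,n-1\},\ \mathrm{t}(\beta)\notin\{1,\dots,n\}\}$, $C=\{\gamma\in\Gamma_1\mid \mathrm{s}(\gamma)\notin\{1,\dots,n\},\ \mathrm{t}(\gamma)\in\{2,\dots,n\}\}$, $D=\{\delta\in\Gamma_1\mid \{\mathrm{s}(\delta),\mathrm{t}(\delta)\}\subset\{1,\dots,n\},\ \delta\notin\{\alpha_1,\dots,\alpha_{n-1}\}\}$. A map $f$ of finitely generated modules is irreducible if it is neither a split monomorphism nor a split epimorphism and $f=gh$ implies that $h$ is a split monomorphism or $g$ is a split epimorphism. *)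

(* Defs.v *)
From HB Require Import structures.
From mathcomp Require Import all_boot all_order all_algebra.
From mathcomp Require Import generic_quotient ring_quotient.
From mathcomp Require Import finmap.
From mathcomp.multinomials Require Import monalg.
From mathcomp Require Import boolp classical_sets.
Set Implicit Arguments.
Unset Strict Implicit.
Unset Printing Implicit Defensive.
Import GRing.Theory.
Local Open Scope classical_set_scope.
Local Open Scope quotient_scope.
Local Open Scope ring_scope.

Record quiver := Quiver {
  vertex : finType;
  arrow : finType;
  src : arrow -> vertex;
  tgt : arrow -> vertex }.

Section Paths.
Variable G : quiver.
Implicit Types (v : vertex G) (s : seq (arrow G)).

Fixpoint composable v s : bool :=
  if s is a :: s' then (src a == v) && composable (tgt a) s' else true.

(* A path is a starting vertex together with its arrows, listed in the order in
   which they are traversed: the product  a_m ... a_1  is the list a_1, ..., a_m. *)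
Definition qpath := {x : vertex G * seq (arrow G) | composable x.1 x.2}.
HB.instance Definition _ := SubChoice.on qpath.

Implicit Types p q r : qpath.

Definition pstart p : vertex G := (val p).1.
Definition parrows p : seq (arrow G) := (val p).2.
Definition plength p : nat := size (parrows p).
Definition pverts p : seq (vertex G) := pstart p :: map (@tgt G) (parrows p).
Definition pend p : vertex G := last (pstart p) (map (@tgt G) (parrows p)).

Definition vpath v : qpath := exist _ (v, [::]) isT.

Lemma composable_arrow a : composable (src a) [:: a].
Proof. by rewrite /= eqxx. Qed.

Definition apath a : qpath := exist _ (src a, [:: a]) (composable_arrow a).

Lemma composable_cat v s1 s2 :
  composable v (s1 ++ s2) =
  composable v s1 && composable (last v (map (@tgt G) s1)) s2.
Proof. by elim: s1 v => //= a s1 IH v; rewrite IH andbA. Qed.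

(* pcomp q p is "first p, then q". *)
Definition pcomp q p : option qpath :=
  if pend p == pstart q then insub (pstart p, parrows p ++ parrows q) else None.

Lemma pcompP q p : pend p = pstart q ->
  {r | pcomp q p = Some r
     & (pstart r = pstart p) * (parrows r = parrows p ++ parrows q)}.
Proof.
move=> e.
have c : composable (pstart p) (parrows p ++ parrows q).
  by rewrite composable_cat (valP p) /= -/(pend p) e (valP q).
exists (exist _ (pstart p, parrows p ++ parrows q) c) => //.
by rewrite /pcomp e eqxx insubT.
Qed.

Lemma pcompN q p : pend p <> pstart q -> pcomp q p = None.
Proof. by move/eqP/negbTE; rewrite /pcomp => ->. Qed.

Lemma qpath_inj p q : pstart p = pstart q -> parrows p = parrows q -> p = q.
Proof.
move=> e1 e2; apply: val_inj; move: e1 e2; rewrite /pstart /parrows.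
by case: (val p) (val q) => [? ?] [? ?] /= -> ->.
Qed.

Lemma pend_comp q p r : pcomp q p = Some r -> pend r = pend q.
Proof.
rewrite /pcomp; case: eqP => // e; case: insubP => // u _ eu [<-].
rewrite /pend [pstart u]/pstart [parrows u]/parrows eu /= map_cat last_cat.
by rewrite -/(pend p) e.
Qed.

Lemma pcompA r q p :
  obind (fun x => pcomp r x) (pcomp q p) = obind (fun x => pcomp x p) (pcomp r q).
Proof.
case: (pselect (pend p = pstart q)) => e1; last first.
  rewrite pcompN //=.
  case: (pselect (pend q = pstart r)) => e2; last by rewrite pcompN.
  have [y -> [ys _]] := pcompP e2.
  by rewrite /= pcompN // ys.
have [x ex [xs xa]] := pcompP e1; rewrite ex /=.
have xe := pend_comp ex.
case: (pselect (pend q = pstart r)) => e2; last first.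
  by rewrite (pcompN e2) /= pcompN // xe.
have [y ey [ys ya]] := pcompP e2; rewrite ey /=.
have [z ez [zs za]] := @pcompP r x (etrans xe e2).
have [z' ez' [zs' za']] := @pcompP y p (etrans e1 (esym ys)).
rewrite ez ez'; congr Some; apply: qpath_inj.
  by rewrite zs zs' xs.
by rewrite za za' xa ya catA.
Qed.

Lemma pcomp_vl v p : pcomp (vpath v) p = if pend p == v then Some p else None.
Proof.
case: eqP => e; last exact: pcompN.
have [r -> [rs ra]] := @pcompP (vpath v) p e.
by congr Some; apply: qpath_inj; rewrite ?rs ?ra ?cats0.
Qed.

Lemma pcomp_vr v p : pcomp p (vpath v) = if pstart p == v then Some p else None.
Proof.
case: eqP => e; last by apply: pcompN => h; apply: e; rewrite -h.
have [r -> [rs ra]] := @pcompP p (vpath v) (esym e).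
by congr Some; apply: qpath_inj; rewrite ?rs ?ra -?e.
Qed.

Definition acyclic_quiver : Prop :=
  forall p, (0 < plength p)%N -> pend p <> pstart p.

End Paths.

(* Elements are finitely supported functions from paths to K.  The operations
   are locked because conversion on the underlying finite maps is very slow. *)
Definition pathalg (K : fieldType) (G : quiver) := {malg K[qpath G]}.
HB.instance Definition _ (K : fieldType) (G : quiver) :=
  Choice.on (pathalg K G).

HB.lock Definition pcoef (K : fieldType) (G : quiver) (p : qpath G)
  (f : pathalg K G) : K := f@_p.
Arguments pcoef {K G} p f.
HB.lock Definition psupp (K : fieldType) (G : quiver) (f : pathalg K G)
  : {fset qpath G} := msupp f.
Arguments psupp {K G} f.
HB.lock Definition pbasis (K : fieldType) (G : quiver) (p : qpath G)
  : pathalg K G := << p >>.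
Arguments pbasis K {G} p.
HB.lock Definition pzero (K : fieldType) (G : quiver) : pathalg K G :=
  (0 : {malg K[qpath G]}).
HB.lock Definition popp (K : fieldType) (G : quiver) (f : pathalg K G)
  : pathalg K G := - (f : {malg K[qpath G]}).
HB.lock Definition padd (K : fieldType) (G : quiver) (f g : pathalg K G)
  : pathalg K G := (f : {malg K[qpath G]}) + g.
HB.lock Definition pscale (K : fieldType) (G : quiver) (c : K) (f : pathalg K G)
  : pathalg K G := c *: (f : {malg K[qpath G]}).

Section PathAlgebraModule.
Variables (K : fieldType) (G : quiver).
Local Notation pathalg := (pathalg K G).
Implicit Types (f g h : pathalg) (p q r : qpath G).

Lemma pathalgP f g : (forall p, pcoef p f = pcoef p g) <-> f = g.
Proof. by rewrite pcoef.unlock; exact: malgP. Qed.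

Lemma padd_coef f g p : pcoef p (padd f g) = pcoef p f + pcoef p g.
Proof. by rewrite pcoef.unlock padd.unlock mcoeffD. Qed.
Lemma popp_coef f p : pcoef p (popp f) = - pcoef p f.
Proof. by rewrite pcoef.unlock popp.unlock mcoeffN. Qed.
Lemma pzero_coef p : pcoef p (pzero K G) = 0.
Proof. by rewrite pcoef.unlock pzero.unlock mcoeff0. Qed.
Lemma pscale_coef c f p : pcoef p (pscale c f) = c * pcoef p f.
Proof. by rewrite pcoef.unlock pscale.unlock mcoeffZ. Qed.

Lemma paddA : associative (@padd K G).
Proof. by move=> f g h; apply/pathalgP => p; rewrite !padd_coef addrA. Qed.
Lemma paddC : commutative (@padd K G).
Proof. by move=> f g; apply/pathalgP => p; rewrite !padd_coef addrC. Qed.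
Lemma padd0 : left_id (pzero K G) (@padd K G).
Proof. by move=> f; apply/pathalgP => p; rewrite padd_coef pzero_coef add0r. Qed.
Lemma paddN : left_inverse (pzero K G) (@popp K G) (@padd K G).
Proof.
by move=> f; apply/pathalgP => p; rewrite padd_coef popp_coef pzero_coef addNr.
Qed.
HB.instance Definition _ := GRing.isZmodule.Build pathalg paddA paddC padd0 paddN.

Lemma pcoefD p f g : pcoef p (f + g) = pcoef p f + pcoef p g.
Proof. exact: padd_coef. Qed.

Lemma pscaleA c d f : pscale c (pscale d f) = pscale (c * d) f.
Proof. by apply/pathalgP => p; rewrite !pscale_coef mulrA. Qed.
Lemma pscale1 : left_id 1 (@pscale K G).
Proof. by move=> f; apply/pathalgP => p; rewrite pscale_coef mul1r. Qed.
Lemma pscaleDr : right_distributive (@pscale K G) +%R.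
Proof.
by move=> c f g; apply/pathalgP => p; rewrite !(pscale_coef, pcoefD) mulrDr.
Qed.
Lemma pscaleDl f : {morph (@pscale K G)^~ f : c d / c + d}.
Proof.
by move=> c d; apply/pathalgP => p; rewrite !(pscale_coef, pcoefD) mulrDl.
Qed.
HB.instance Definition _ :=
  GRing.Zmodule_isLmodule.Build K pathalg pscaleA pscale1 pscaleDr pscaleDl.

Lemma pcoef_is_linear p : scalar (pcoef p : pathalg -> K).
Proof. by move=> c f g; rewrite pcoefD [pcoef p (c *: f)]pscale_coef. Qed.
HB.instance Definition _ p :=
  GRing.isLinear.Build K pathalg K *%R (pcoef p) (pcoef_is_linear p).

Lemma pcoef_basis p q : pcoef p (pbasis K q) = (q == p)%:R.
Proof. by rewrite pcoef.unlock pbasis.unlock mcoeffU. Qed.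

Lemma pcoef_neq0 p f : (pcoef p f != 0) = (p \in psupp f).
Proof. by rewrite pcoef.unlock psupp.unlock mcoeff_neq0. Qed.

Lemma pathalgE f : f = \sum_(p <- psupp f) pcoef p f *: pbasis K p.
Proof.
apply/pathalgP => k; rewrite linear_sum /=.
under eq_bigr do rewrite linearZ /= pcoef_basis.
have [kf|kf] := boolP (k \in psupp f).
  rewrite (big_fsetD1 k) //= eqxx mulr1 big1_fset ?addr0 // => p.
  by rewrite in_fsetD1 => /andP[/negbTE -> _] _; rewrite mulr0.
rewrite big1_fset => [|p pf _].
  by apply/eqP; rewrite -[_ == _]negbK pcoef_neq0.
by case: eqP pf kf => [-> -> //|]; rewrite mulr0.
Qed.

Definition plext (V : lmodType K) (F : qpath G -> V) f : V :=
  \sum_(p <- psupp f) pcoef p f *: F p.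

Lemma plextEw (V : lmodType K) (F : qpath G -> V) f (d : {fset qpath G}) :
  (psupp f `<=` d)%fset -> plext F f = \sum_(p <- d) pcoef p f *: F p.
Proof.
move=> le; rewrite /plext (big_fset_incl _ le) //= => k _.
by rewrite -pcoef_neq0 negbK => /eqP ->; rewrite scale0r.
Qed.

Lemma plext_is_linear (V : lmodType K) (F : qpath G -> V) : linear (plext F).
Proof.
move=> c f g.
pose d := (psupp f `|` psupp g `|` psupp (c *: f + g)%R)%fset.
rewrite (@plextEw _ _ f d); last first.
  by apply/fsubsetP => k kf; rewrite !in_fsetU kf.
rewrite (@plextEw _ _ g d); last first.
  by apply/fsubsetP => k kf; rewrite !in_fsetU kf orbT.
rewrite (@plextEw _ _ _ d); last first.
  by apply/fsubsetP => k kf; rewrite !in_fsetU kf !orbT.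
rewrite scaler_sumr -big_split /=; apply: eq_bigr => k _.
by rewrite linearP scalerDl scalerA.
Qed.
HB.instance Definition _ (V : lmodType K) (F : qpath G -> V) :=
  GRing.isLinear.Build K pathalg V _ (plext F) (plext_is_linear F).

Lemma plext_basis (V : lmodType K) (F : qpath G -> V) p :
  plext F (pbasis K p) = F p.
Proof.
rewrite (@plextEw _ _ _ [fset p]%fset); last first.
  by rewrite psupp.unlock pbasis.unlock; exact: msuppU_le.
by rewrite big_seq_fset1 pcoef_basis eqxx scale1r.
Qed.

End PathAlgebraModule.

HB.lock Definition pbmul (K : fieldType) (G : quiver) (q p : qpath G)
  : pathalg K G := oapp (pbasis K) 0 (pcomp q p).
Arguments pbmul K {G} q p.
HB.lock Definition pmul (K : fieldType) (G : quiver) (f g : pathalg K G)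
  : pathalg K G := plext (fun q => plext (pbmul K q) g) f.
Arguments pmul {K G} f g.
HB.lock Definition pone (K : fieldType) (G : quiver)
  : pathalg K G := \sum_(v : vertex G) pbasis K (vpath v).
Arguments pone K G.

Section PathAlgebraRing.
Variables (K : fieldType) (G : quiver).
Local Notation pathalg := (pathalg K G).
Local Notation pbasis := (pbasis K).
Local Notation pbmul := (pbmul K).
Local Notation pone := (pone K G).
Local Notation pmul := (@pmul K G).
Implicit Types (f g h : pathalg) (p q r : qpath G).

Let pmull g f := pmul f g.
Lemma pmul_linl g : linear (pmull g).
Proof. by rewrite /pmull => c f h; rewrite pmul.unlock linearP. Qed.
HB.instance Definition _ g :=
  GRing.isLinear.Build K pathalg pathalg _ (pmull g) (pmul_linl g).

Lemma pmul_linr f : linear (pmul f).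
Proof.
move=> c g h; rewrite pmul.unlock [in RHS]/plext scaler_sumr -big_split /=.
apply: eq_bigr => q _; rewrite linearP /= scalerDr !scalerA.
by rewrite mulrC.
Qed.
HB.instance Definition _ f :=
  GRing.isLinear.Build K pathalg pathalg _ (pmul f) (pmul_linr f).

Lemma pmulbb q p : pmul (pbasis q) (pbasis p) = pbmul q p.
Proof. by rewrite pmul.unlock !plext_basis. Qed.

Lemma pmulZl c f g : pmul (c *: f) g = c *: pmul f g.
Proof. exact: (linearZZ (pmull g)). Qed.
Lemma pmulZr c f g : pmul f (c *: g) = c *: pmul f g.
Proof. exact: (linearZZ (pmul f)). Qed.
Lemma pmulDl : left_distributive pmul +%R.
Proof. by move=> f g h; exact: (linearD (pmull h)). Qed.
Lemma pmulDr : right_distributive pmul +%R.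
Proof. by move=> f g h; exact: (linearD (pmul f)). Qed.
Lemma pmul0r : left_zero 0 pmul.
Proof. by move=> f; exact: (linear0 (pmull f)). Qed.
Lemma pmulr0 : right_zero 0 pmul.
Proof. by move=> f; exact: (linear0 (pmul f)). Qed.
Lemma pmul_suml I (s : seq I) (F : I -> pathalg) g :
  pmul (\sum_(i <- s) F i) g = \sum_(i <- s) pmul (F i) g.
Proof. exact: (linear_sum (pmull g)). Qed.
Lemma pmul_sumr I (s : seq I) (F : I -> pathalg) f :
  pmul f (\sum_(i <- s) F i) = \sum_(i <- s) pmul f (F i).
Proof. exact: (linear_sum (pmul f)). Qed.

Lemma pbmulA r q p : pmul (pbasis r) (pbmul q p) = pmul (pbmul r q) (pbasis p).
Proof.
have := pcompA r q p; rewrite pbmul.unlock.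
case: (pcomp q p) (pcomp r q) => [x|] [y|] /= e;
  rewrite ?pmulr0 ?pmul0r ?pmulbb ?pbmul.unlock ?e //.
by rewrite -e.
Qed.

Lemma pmulA : associative pmul.
Proof.
move=> f g h.
rewrite [f]pathalgE !pmul_suml; apply: eq_bigr => r _.
rewrite !pmulZl; congr (_ *: _).
rewrite [g]pathalgE !(pmul_suml, pmul_sumr); apply: eq_bigr => q _.
rewrite !(pmulZl, pmulZr); congr (_ *: _).
rewrite [h]pathalgE !pmul_sumr; apply: eq_bigr => p _.
by rewrite !pmulZr !pmulbb pbmulA.
Qed.

Lemma pmul1r : left_id pone pmul.
Proof.
move=> f; rewrite [f]pathalgE pmul_sumr; apply: eq_bigr => p _.
rewrite pmulZr pone.unlock pmul_suml; congr (_ *: _).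
rewrite (bigD1 (pend p)) //= pmulbb pbmul.unlock pcomp_vl eqxx /=.
rewrite big1 ?addr0 // => v /negbTE ne.
by rewrite pmulbb pbmul.unlock pcomp_vl eq_sym ne.
Qed.

Lemma pmulr1 : right_id pone pmul.
Proof.
move=> f; rewrite [f]pathalgE pmul_suml; apply: eq_bigr => p _.
rewrite pmulZl pone.unlock pmul_sumr; congr (_ *: _).
rewrite (bigD1 (pstart p)) //= pmulbb pbmul.unlock pcomp_vr eqxx /=.
rewrite big1 ?addr0 // => v /negbTE ne.
by rewrite pmulbb pbmul.unlock pcomp_vr eq_sym ne.
Qed.


HB.instance Definition _ := GRing.Zmodule_isPzRing.Build pathalg
  pmulA pmul1r pmulr1 pmulDl pmulDr.

Lemma pathalg_scaleAl (c : K) f g : c *: (f * g) = (c *: f) * g.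
Proof. exact: esym (pmulZl c f g). Qed.
Lemma pathalg_scaleAr (c : K) f g : c *: (f * g) = f * (c *: g).
Proof. exact: esym (pmulZr c f g). Qed.
Lemma pbasisM q p : pbasis q * pbasis p = oapp pbasis 0 (pcomp q p).
Proof. by rewrite [LHS]pmulbb pbmul.unlock. Qed.
Lemma pathalg1E : 1 = \sum_(v : vertex G) pbasis (vpath v) :> pathalg.
Proof. by rewrite -[LHS]/pone pone.unlock. Qed.

End PathAlgebraRing.

Definition is_ideal (A : pzRingType) (I : set A) : Prop :=
  [/\ I 0, (forall x y, I x -> I y -> I (x - y)),
      (forall a x, I x -> I (a * x)) & (forall a x, I x -> I (x * a))].

Record ideal (A : pzRingType) := Ideal {
  ideal_set :> set A;
  idealP : is_ideal ideal_set }.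

(* The additive span of all op x y with x in X and y in Y; this gives products
   X Y of ideals, and X V for an ideal X and a module V. *)
Definition sumset (A B : Type) (V : nmodType) (op : A -> B -> V)
    (X : set A) (Y : set B) : set V :=
  [set z | exists n (x : 'I_n -> A) (y : 'I_n -> B),
    [/\ forall i, X (x i), forall i, Y (y i) & z = \sum_i op (x i) (y i)]].

(* As A is unital, X^1 = X A = X for a two-sided ideal X. *)
Definition ideal_exp (A : pzRingType) (X : set A) (m : nat) : set A :=
  iter m (sumset *%R X) setT.

Definition arrow_ideal (K : fieldType) (G : quiver) : set (pathalg K G) :=
  [set x | forall I : set (pathalg K G), is_ideal I ->
             (forall a, I (pbasis K (apath a))) -> I x].

Definition admissible (K : fieldType) (G : quiver) (I : set (pathalg K G)) :=
  exists2 m, (2 <= m)%N &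
    ideal_exp (@arrow_ideal K G) m `<=` I /\
    I `<=` ideal_exp (@arrow_ideal K G) 2.

Section Quotient.
Variables (K : fieldType) (G : quiver) (I : ideal (pathalg K G)).

Definition ideal_pred (x : pathalg K G) : bool := `[< ideal_set I x >].
Lemma ideal_predP x : reflect (ideal_set I x) (x \in ideal_pred).
Proof. exact: asboolP. Qed.

Lemma ideal_pred_zmod : zmod_closed ideal_pred.
Proof.
have [I0 IB _ _] := idealP I; split; first exact/ideal_predP.
by move=> x y /ideal_predP Ix /ideal_predP Iy; apply/ideal_predP/IB.
Qed.
HB.instance Definition _ :=
  GRing.isZmodClosed.Build (pathalg K G) ideal_pred ideal_pred_zmod.

Definition ideal_zmod := GRing.ZmodClosed.clone (pathalg K G) ideal_pred _.

Definition quotalg := Quotient.quot ideal_zmod.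
HB.instance Definition _ := GRing.Zmodule.on quotalg.

Definition qclass (x : pathalg K G) : quotalg :=
  \pi_(Quotient.quot ideal_zmod) x.
Definition qrepr (x : quotalg) : pathalg K G := repr x.

Lemma qclassP x y : qclass x = qclass y <-> ideal_set I (x - y).
Proof.
split=> [/eqP|h]; first by rewrite -Quotient.idealrBE => /ideal_predP.
by apply/eqP; rewrite -Quotient.idealrBE; apply/ideal_predP.
Qed.

Lemma qreprK : cancel qrepr qclass.
Proof. exact: reprK. Qed.

Lemma qclassD : {morph qclass : x y / x + y}.
Proof. exact: (raddfD \pi_(Quotient.quot ideal_zmod)). Qed.

Lemma qreprE x : ideal_set I (qrepr (qclass x) - x).
Proof. by apply/qclassP; rewrite qreprK. Qed.

Definition qone : quotalg := qclass 1.
Definition qmul (x y : quotalg) : quotalg := qclass (qrepr x * qrepr y).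
Definition qscale (c : K) (x : quotalg) : quotalg := qclass (c *: qrepr x).

Lemma qclass_mul x y : qmul (qclass x) (qclass y) = qclass (x * y).
Proof.
apply/qclassP; have [_ IB Il Ir] := idealP I.
set x' := qrepr _; set y' := qrepr _.
have -> : x' * y' - x * y = x' * (y' - y) - (x - x') * y.
  by rewrite mulrBr mulrBl opprB addrA subrK.
apply: IB; first exact/Il/qreprE.
by apply/Ir/qclassP; rewrite qreprK.
Qed.

Lemma qclass_scale c x : qscale c (qclass x) = qclass (c *: x).
Proof.
apply/qclassP; have [_ _ Il _] := idealP I.
by rewrite -scalerBr -[_ - _]mul1r pathalg_scaleAl; apply/Il/qreprE.
Qed.

Lemma qmulA : associative qmul.
Proof.
move=> x y z; rewrite -[x]qreprK -[y]qreprK -[z]qreprK.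
by rewrite !qclass_mul mulrA.
Qed.
Lemma qmul1r : left_id qone qmul.
Proof. by move=> x; rewrite -[x]qreprK qclass_mul mul1r. Qed.
Lemma qmulr1 : right_id qone qmul.
Proof. by move=> x; rewrite -[x]qreprK qclass_mul mulr1. Qed.
Lemma qmulDl : left_distributive qmul +%R.
Proof.
move=> x y z; rewrite -[x]qreprK -[y]qreprK -[z]qreprK.
by rewrite -qclassD !qclass_mul mulrDl qclassD.
Qed.
Lemma qmulDr : right_distributive qmul +%R.
Proof.
move=> x y z; rewrite -[x]qreprK -[y]qreprK -[z]qreprK.
by rewrite -qclassD !qclass_mul mulrDr qclassD.
Qed.
HB.instance Definition _ :=
  GRing.Zmodule_isPzRing.Build quotalg qmulA qmul1r qmulr1 qmulDl qmulDr.

Lemma qscaleA c d x : qscale c (qscale d x) = qscale (c * d) x.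
Proof. by rewrite -[x]qreprK !qclass_scale scalerA. Qed.
Lemma qscale1 : left_id 1 qscale.
Proof. by move=> x; rewrite -[x]qreprK qclass_scale scale1r. Qed.
Lemma qscaleDr : right_distributive qscale +%R.
Proof.
move=> c x y; rewrite -[x]qreprK -[y]qreprK.
by rewrite -qclassD !qclass_scale scalerDr qclassD.
Qed.
Lemma qscaleDl x : {morph qscale^~ x : c d / c + d}.
Proof.
by move=> c d; rewrite -[x]qreprK !qclass_scale scalerDl qclassD.
Qed.
HB.instance Definition _ :=
  GRing.Zmodule_isLmodule.Build K quotalg qscaleA qscale1 qscaleDr qscaleDl.

Lemma qclassM : {morph qclass : x y / x * y}.
Proof. by move=> x y; rewrite [RHS]qclass_mul. Qed.
Lemma qclassZ c : {morph qclass : x / c *: x}.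
Proof. by move=> x; rewrite [RHS]qclass_scale. Qed.
Lemma qclass1 : qclass 1 = 1.
Proof. by []. Qed.

End Quotient.

Section Modules.
Variable A : pzRingType.
Implicit Types U V M N : lmodType A.

Definition submodule V (S : set V) : Prop :=
  S 0 /\ forall a x y, S x -> S y -> S (a *: x + y).

Definition maximal_submodule V (S : set V) : Prop :=
  [/\ submodule S, S <> setT &
      forall T, submodule T -> S `<=` T -> T = S \/ T = setT].

Definition jacobson : set A :=
  [set x | forall L : set A^o, maximal_submodule L -> L x].

Definition finitely_generated V : Prop :=
  exists n (g : 'I_n -> V), forall x, exists a : 'I_n -> A,
    x = \sum_i a i *: g i.

Definition simple_module V : Prop :=
  (exists x : V, x <> 0) /\
  forall S : set V, submodule S -> S = [set 0] \/ S = setT.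

(* By the correspondence theorem, this says that T / S is simple. *)
Definition simple_factor V (S T : set V) : Prop :=
  [/\ S `<=` T, S <> T &
      forall X, submodule X -> S `<=` X -> X `<=` T -> X = S \/ X = T].

(* 0 = S_0 < S_1 < ... < S_l = V, given as the list S_0, ..., S_l *)
Definition composition_series V (s : seq (set V)) : Prop :=
  [/\ head set0 s = [set 0], last set0 s = setT,
      forall i, (i < size s)%N -> submodule (nth set0 s i) &
      forall i, (i.+1 < size s)%N ->
        simple_factor (nth set0 s i) (nth set0 s i.+1)].

Definition uniserial V : Prop := exists! s : seq (set V), composition_series s.

Definition module_length V (n : nat) : Prop :=
  exists2 s : seq (set V), composition_series s & size s = n.+1.

Definition split_mono M N (f : {linear M -> N}) : Prop :=
  exists g : {linear N -> M}, cancel f g.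
Definition split_epi M N (f : {linear M -> N}) : Prop :=
  exists g : {linear N -> M}, cancel g f.

Definition irreducible_map M N (f : {linear M -> N}) : Prop :=
  [/\ ~ split_mono f, ~ split_epi f &
      forall (X : lmodType A) (h : {linear M -> X}) (g : {linear X -> N}),
        finitely_generated X -> f =1 g \o h -> split_mono h \/ split_epi g].

End Modules.
Arguments jacobson A : clear implicits.

Section RadicalModule.
Variables (A : pzRingType) (U : lmodType A).

Definition rad_pred (u : U) : bool :=
  `[< sumset (fun (a : A) (x : U) => a *: x) (jacobson A) setT u >].

Lemma rad_predP u : reflect
  (sumset (fun (a : A) (x : U) => a *: x) (jacobson A) setT u) (u \in rad_pred).
Proof. exact: asboolP. Qed.

Lemma jacobsonMl (a x : A) : jacobson A x -> jacobson A (a * x).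
Proof.
move=> Jx L Lmax; have [[L0 Ls] _ _] := Lmax.
by have := Ls a x 0 (Jx L Lmax) L0; rewrite addr0.
Qed.

Lemma rad_pred_submod : submod_closed rad_pred.
Proof.
split; first by apply/rad_predP; exists 0%N, (fun=> 0), (fun=> 0);
  split=> [[]|[]|] //; rewrite big_ord0.
move=> a u v /rad_predP[m [x [y [xJ _ ->]]]] /rad_predP[n [x' [y' [xJ' _ ->]]]].
apply/rad_predP; exists (m + n)%N.
exists (fun i => match split i with inl j => a * x j | inr k => x' k end).
exists (fun i => match split i with inl j => y j | inr k => y' k end).
split=> // [i|]; first by case: (split i) => j //; exact: jacobsonMl.
rewrite big_split_ord /= scaler_sumr; congr (_ + _); apply: eq_bigr => i _.
  by rewrite (unsplitK (inl i)) scalerA.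
by rewrite (unsplitK (inr i)).
Qed.
HB.instance Definition _ :=
  GRing.isSubmodClosed.Build A U rad_pred rad_pred_submod.

Definition radical_module := {u : U | u \in rad_pred}.
HB.instance Definition _ := SubChoice.on radical_module.
HB.instance Definition _ :=
  [SubChoice_isSubLmodule of radical_module by <:].

Definition radical_embedding : {linear radical_module -> U} := val.

End RadicalModule.

Section Mast.
Variables (K : fieldType) (G : quiver) (I : ideal (pathalg K G)).
Implicit Types (p : qpath G) (v : vertex G).

Definition path_class p : quotalg I := qclass I (pbasis K p).

(* A uniserial module of length n has a mast p with n - 1 arrows. *)
Definition mast (U : lmodType (quotalg I)) p : Prop :=
  module_length U (plength p).+1 /\ exists x : U, path_class p *: x <> 0.

Definition arrow_class (a : arrow G) : quotalg I := path_class (apath a).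

(* The class of a_m ... a_1 for the list a_1, ..., a_m, and 1 for the empty list *)
Definition arrows_class (s : seq (arrow G)) : quotalg I :=
  \prod_(a <- rev s) arrow_class a.

(* If v is the vertex numbered i (counting from 1) of p = a_(n-1) ... a_1, then
   mast_to p v is a_(i-1) ... a_1 and mast_from p v is a_(n-1) ... a_i.
   The vertices of p are distinct when the quiver is acyclic. *)
Definition mast_to p v : quotalg I :=
  arrows_class (take (index v (pverts p)) (parrows p)).
Definition mast_from p v : quotalg I :=
  arrows_class (drop (index v (pverts p)) (parrows p)).

Definition arrowsB p : set (arrow G) :=
  [set b | src b \in take (plength p) (pverts p) /\ tgt b \notin pverts p].
Definition arrowsC p : set (arrow G) :=
  [set c | src c \notin pverts p /\ tgt c \in behead (pverts p)].
Definition arrowsD p : set (arrow G) :=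
  [set d | [/\ src d \in pverts p, tgt d \in pverts p & d \notin parrows p]].

Definition mulset_r (X : set (quotalg I)) (x : quotalg I) : set (quotalg I) :=
  [set a * x | a in X].
Definition mulset_l (x : quotalg I) (X : set (quotalg I)) : set (quotalg I) :=
  [set x * a | a in X].

Definition Kline (x : quotalg I) : set (quotalg I) :=
  [set c *: x | c in (setT : set K)].

(* The classes of the members of X modulo W form a K-basis of V / W *)
Definition basis_mod (V W : set (quotalg I)) (X : seq (quotalg I)) : Prop :=
  [/\ forall i, (i < size X)%N -> V X`_i,
      forall y, V y -> exists c : 'I_(size X) -> K,
        W (y - \sum_(i < size X) c i *: X`_i) &
      forall c : 'I_(size X) -> K,
        W (\sum_(i < size X) c i *: X`_i) -> forall i, c i = 0].

End Mast.

(* Main.v *)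
Require Import Defs.
From HB Require Import structures.
From mathcomp Require Import all_boot all_order all_algebra.
From mathcomp Require Import generic_quotient ring_quotient.
From mathcomp Require Import boolp classical_sets functions.
Set Implicit Arguments.
Unset Strict Implicit.
Unset Printing Implicit Defensive.
Import GRing.Theory.
Local Open Scope classical_set_scope.
Local Open Scope quotient_scope.
Local Open Scope ring_scope.

(** Write A for the algebra, J for its radical, e_v for the idempotent of a
    vertex v, and v_0, ..., v_l for the vertices of the mast.  Let T_i be the
    part of the mast from v_0 to v_i and F_i the part from v_i to v_l, so that
    P = T_l = F_0 is the class of the whole mast.  Since U has length l + 1 and
    P does not kill U, some x = e_(v_0) x in U has the T_i x as a K-basis of U,
    and the coordinate of u at T_i x is xi (F_i u), where xi reads the
    coordinate at the socle vector P x ([bas_decomp]).  As the quiver has no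
    directed cycles, e_v J e_w = 0 whenever some path leads from v to w
    ([reach_jacobson0]); this turns congruences modulo J P or P J into
    equalities.

    The embedding of JU into U has simple cokernel S.  By a criterion of
    Auslander and Reiten it is irreducible, once it does not split, exactly if
    for every f : V -> S either f lifts to V -> U or U -> S lifts to U -> V.
    The proof makes both halves of this explicit.

    Conditions imply irreducibility ([factor_split_mono]).  Let g h be the
    embedding, with g : X -> U not a split epimorphism.  The conditions on the
    arrows in B and D say that A e_(v_0) is spanned by the T_i and J P.  Hence a
    vector v of e_(v_0) X with J P v = 0 and g v outside JU would define a
    section of g, so xi (P g v) depends only on the family of the r P v, r in R,
    and is the value at that family of some functional L on X^R.  The conditions
    on the arrows in C and D say precisely that the map phi sending v to the sum
    of the L((r F_i v)_r) T_i x is A-linear.  It kills the image of h, and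
    g - phi has values in JU, so g - phi is a retraction of h.

    Irreducibility implies the conditions on B and D ([annihilator_top]).
    Factor the embedding through (A + JU) / {(b P, - b P x)}.  The map from JU
    does not split, because P kills JU but not x; so the map to U does, and the
    image of x under a section shows that the annihilator of x in A e_(v_0) is
    contained in A P.

    Irreducibility implies the existence of R ([dual_tuple]).  The arrows a that
    start at v_l give a basis of J P / J^2 P; let z be their family, an element
    of the right module Q = A^m.  Factor the embedding through the module of
    pairs (f, u), where f is a functional on Q that vanishes on z P J and f(z P)
    is the top coordinate of u.  A section of the projection to U would give
    an f with f(z P) = 1 and a P f = 0 for all the arrows a, which forces
    f(z P) = 0.  So the map from JU has a retraction.  It
    induces a linear map from the functionals f to U, and composing it with xi
    gives the evaluation at some z' in Q because Q is finite-dimensional.  As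
    functionals separate points from z P J, linearity yields z' P = z P,
    z' F_j c in z P J for c in C, and z' F_j d in K z' F_i for an arrow d in D
    from v_i to v_j.  The components of z', cut by idempotents, form R. *)

(** * Functionals and bases in vector spaces *)

Section LinearAlgebra.
Variables (K : fieldType) (W : lmodType K).

Definition subspace (S : set W) : Prop :=
  S 0 /\ forall c x y, S x -> S y -> S (c *: x + y).

Lemma subspaceZ S c x : subspace S -> S x -> S (c *: x).
Proof. by move=> [S0 SP] Sx; rewrite -[_ *: _]addr0; apply: SP. Qed.

Lemma subspaceD S x y : subspace S -> S x -> S y -> S (x + y).
Proof. by move=> [S0 SP] Sx Sy; rewrite -[x]scale1r; apply: SP. Qed.

Lemma subspaceB S x y : subspace S -> S x -> S y -> S (x - y).
Proof. by move=> [S0 SP] Sx Sy; rewrite addrC -scaleN1r; apply: SP. Qed.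

Lemma subspace_sum S (T : Type) (r : seq T) (Q : pred T) F :
  subspace S -> (forall i, Q i -> S (F i)) -> S (\sum_(i <- r | Q i) F i).
Proof.
move=> sS SF; elim/big_ind: _ => //; first by case: sS.
by move=> x y; apply: subspaceD.
Qed.

(** The graph of a linear functional defined on some subspace of W.  Graphs
    avoid naming the domain and make the functionals a family of sets, ordered
    by inclusion, to which Zorn's lemma applies. *)
Definition pfunctional (F : set (W * K^o)) : Prop :=
  [/\ F (0, 0), forall c x a y b, F (x, a) -> F (y, b) -> F (c *: x + y, c * a + b)
    & forall a, F (0, a) -> a = 0].

Let pfE F x a b : pfunctional F -> F (x, a) -> F (x, b) -> a = b.
Proof.
case=> [F0 FP Fi] Fa Fb; have := FP (-1) _ _ _ _ Fa Fb.
by rewrite scaleN1r addNr mulN1r => /Fi/eqP; rewrite addrC subr_eq0 => /eqP.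
Qed.

(** Zorn's lemma gives a maximal graph; if x were outside its domain, adding
    the multiples of (x, 0) would enlarge it. *)
Lemma functional_extension (F : set (W * K^o)) : pfunctional F ->
  exists2 f : {scalar W}, True & forall x a, F (x, a) -> f x = a.
Proof.
move=> pF.
have [] := @Zorn_bigcup (W * K^o)%type
  (fun E => E = set0 \/ (pfunctional E /\ F `<=` E)).
  move=> C PC totC.
  have [C0|] := pselect (forall E, C E -> E = set0).
    left; apply/seteqP; split => // x [E CE Ex]; move: (C0 _ CE) Ex => -> [].
  move=> /existsNP[E0 /not_implyP[CE0 E0n]]; right.
  have [E00|[pE0 FE0]] := PC _ CE0; first by [].
  split; last by move=> z Fz; exists E0 => //; apply: FE0.
  have pC E z : C E -> E z -> pfunctional E.
    by move=> CE Ez; case: (PC _ CE) => [E1|[]//]; move: Ez; rewrite E1.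
  split.
  - by exists E0 => //; case: pE0.
  - move=> c x a y b [E1 CE1 E1x] [E2 CE2 E2y].
    have [le|le] := totC _ _ CE1 CE2; [exists E2 => //|exists E1 => //].
      by have [_ h _] := pC _ _ CE2 E2y; apply: h => //; apply: le.
    by have [_ h _] := pC _ _ CE1 E1x; apply: h => //; apply: le.
  - by move=> a [E CE Ea]; have [_ _ h] := pC _ _ CE Ea; apply: h.
move=> E [PE maxE].
have [pE FE] : pfunctional E /\ F `<=` E.
  case: PE => // E0; case: (maxE F); last by right; split.
  by rewrite E0; split=> // h; case: pF => F0 _ _; case: (h _ F0).
have [E0 EP Ei] := pE.
have tot x : exists a, E (x, a).
  apply: contrapT => /forallNP nx.
  pose E' : set (W * K^o) :=
    [set z | exists c y a, E (y, a) /\ z = (c *: x + y, a)].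
  have EE' : E `<=` E'.
    by move=> [y a] Ey; exists 0, y, a; rewrite scale0r add0r.
  apply: (maxE E').
    split=> // h; apply: (nx 0); apply: h.
    by exists 1, 0, 0; rewrite scale1r addr0.
  right; split; last by move=> z /FE/EE'.
  split; first exact: EE'.
  - move=> c y a y' b [d [z [a1 [Ez [-> ->]]]]] [d' [z' [a1' [Ez' [-> ->]]]]].
    exists (c * d + d'), (c *: z + z'), (c * a1 + a1'); split; first exact: EP.
    by rewrite scalerDr scalerA scalerDl addrACA.
  - move=> a [c [y [a1 [Ey [eq0 ->]]]]].
    have [c0|c0] := eqVneq c 0.
      by move: eq0 Ey; rewrite c0 scale0r add0r => <-; apply: Ei.
    case: (nx (- c^-1 * a1)).
    have -> : x = (- c^-1) *: y + 0.
      rewrite addr0; apply: (scalerI c0); rewrite scalerA mulrN divff // scaleN1r.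
      by apply/eqP; rewrite -addr_eq0 -eq0.
    by rewrite -[- _ * _]addr0; apply: EP.
pose f (x : W) : K^o := xget 0 [set a | E (x, a)].
have fE x : E (x, f x).
  by have [a Ea] := tot x; apply: (@xgetPex _ 0 [set a | E (x, a)]); exists a.
have fl : scalar f.
  by move=> c x y; apply: (pfE pE (fE _)); apply: EP; apply: fE.
pose g : {scalar W} := HB.pack f (GRing.isLinear.Build _ _ _ _ f fl).
exists g; first by [].
by move=> x a /FE Ex; exact: (pfE pE (fE x) Ex).
Qed.

Lemma separate (S : set W) y : subspace S ->
  (forall f : {scalar W}, (forall x, S x -> f x = 0) -> f y = 0) -> S y.
Proof.
move=> sS fy; apply: contrapT => nSy.
have [|f _ fE] := @functional_extension
    [set z | exists c x, S x /\ z = (c *: y + x, c)].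
  split.
  - by exists 0, 0; rewrite scale0r addr0; case: sS.
  - move=> c x a x' b [d [z [Sz [-> ->]]]] [d' [z' [Sz' [-> ->]]]].
    exists (c * d + d'), (c *: z + z'); split; first by case: sS => _; apply.
    by rewrite scalerDr scalerA scalerDl addrACA.
  - move=> a [c [x [Sx [/esym/eqP eq0 ->]]]]; apply: contrapT => /eqP c0.
    apply: nSy; rewrite (_ : y = (- c^-1) *: x); first exact: subspaceZ.
    apply: (scalerI c0); rewrite scalerA mulrN divff // scaleN1r.
    by apply/eqP; rewrite -addr_eq0.
have f1 : f y = 1 by apply: fE; exists 1, 0; rewrite scale1r addr0; case: sS.
suff : f y = 0 by rewrite f1 => /eqP; rewrite oner_eq0.
by apply: fy => x Sx; apply: fE; exists 0, x; rewrite scale0r add0r.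
Qed.

Definition spanned (s : seq W) (S : set W) : Prop :=
  forall y, S y -> exists c : 'I_(size s) -> K, y = \sum_i c i *: s`_i.

(** Induction on the number of functionals: a vector of S on which the first
    one does not vanish, together with a spanning list of the kernel of that
    functional in S, spans S. *)
Lemma finite_span (n : nat) (f : 'I_n -> {scalar W}) (S : set W) : subspace S ->
  (forall x, S x -> (forall i, f i x = 0) -> x = 0) ->
  exists2 s : seq W, (forall x, x \in s -> S x) & spanned s S.
Proof.
elim: n f S => [|n IH] f S sS sep.
  exists [::] => // y Sy; exists (fun=> 0); rewrite big_ord0.
  by apply: sep => // -[].
pose S' := [set x | S x /\ f ord0 x = 0].
have sS' : subspace S'.
  split; first by split; [case: sS|rewrite linear0].
  move=> c x y [Sx fx] [Sy fy]; split; first by case: sS => _; apply.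
  by rewrite linearP /= fx fy mulr0 addr0.
have [|s sS1 span] := IH (fun i => f (lift ord0 i)) S' sS'.
  move=> x [Sx fx] h; apply: sep => // i.
  by case: (unliftP ord0 i) => [j ->|->].
have [h|/existsNP[x0 /not_implyP[Sx0 /eqP fx0]]] :=
    pselect (forall x, S x -> f ord0 x = 0).
  exists s => [x /sS1[]//|y Sy].
  by apply: span; split => //; apply: h.
exists (x0 :: s) => [x|y Sy].
  by rewrite inE => /orP[/eqP ->//|/sS1[]].
pose d := f ord0 y / f ord0 x0.
have [|c yc] := span (y - d *: x0).
  split; first by apply: subspaceB => //; apply: subspaceZ.
  by rewrite linearB linearZ /= /d divfK // subrr.
exists (fun i => oapp c d (unlift ord0 i)).
rewrite big_ord_recl unlift_none /=.
under eq_bigr do rewrite liftK /=.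
by rewrite -yc addrC subrK.
Qed.

(** Greedy choice of a basis modulo S among the f t: a new vector is kept only
    if it is not in the span of the previous ones. *)
Lemma basis_extract (T : eqType) (f : T -> W) (S : set W) (r : seq T) : subspace S ->
  exists s : seq T, [/\ {subset s <= r},
    forall t, t \in r -> exists c : 'I_(size s) -> K,
       S (f t - \sum_i c i *: (map f s)`_i) &
    forall c : 'I_(size s) -> K, S (\sum_i c i *: (map f s)`_i) ->
       forall i, c i = 0].
Proof.
move=> sS; elim: r => [|a r [s [sr span indep]]].
  by exists [::]; split=> // c _ [].
have [[c hc]|nc] := pselect (exists c : 'I_(size s) -> K,
    S (f a - \sum_i c i *: (map f s)`_i)).
  exists s; split=> // t; first by rewrite inE => /sr ->; rewrite orbT.
  by rewrite inE => /orP[/eqP ->|/span//]; exists c.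
exists (a :: s); split.
- by move=> t; rewrite !inE => /orP[->//|/sr ->]; rewrite orbT.
- move=> t; rewrite inE => /orP[/eqP ->|/span[c hc]].
    exists (fun i => (i == ord0)%:R); rewrite big_ord_recl /= scale1r big1.
      by rewrite addr0 subrr; case: sS.
    by move=> i _; rewrite scale0r.
  exists (fun i => oapp c 0 (unlift ord0 i)).
  rewrite big_ord_recl unlift_none /= scale0r add0r.
  by under eq_bigr do rewrite liftK /=.
- move=> c; rewrite big_ord_recl /= => h.
  have c0 : c ord0 = 0.
    apply: contrapT => /eqP c0; apply: nc.
    exists (fun i => - (c ord0)^-1 * c (lift ord0 i)).
    have -> : f a - \sum_(i < size s) - (c ord0)^-1 * c (lift ord0 i) *: (map f s)`_i
       = (c ord0)^-1 *: (c ord0 *: f a + \sum_(i < size s) c (lift ord0 i) *: (map f s)`_i).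
      rewrite scalerDr scalerA mulVf // scale1r scaler_sumr -sumrN.
      by congr (_ + _); apply: eq_bigr => i _; rewrite mulNr scaleNr opprK scalerA.
    exact: subspaceZ.
  move: h; rewrite c0 scale0r add0r => /indep h i.
  by case: (unliftP ord0 i) => [j ->|->].
Qed.

End LinearAlgebra.

(** * Path classes and the Jacobson radical *)

Section PathClasses.
Variables (K : fieldType) (G : quiver) (I : ideal (pathalg K G)).
Local Notation A := (quotalg I).
Local Notation pc := (path_class I).
Local Notation e v := (path_class I (vpath v)).
Implicit Types (a b x y : A) (p q : qpath G) (v w : vertex G).

Lemma qclass0 : qclass I 0 = 0.
Proof. by apply: (addrI (qclass I 0)); rewrite -qclassD !addr0. Qed.

Lemma qclass_sum (T : Type) (r : seq T) (F : T -> pathalg K G) :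
  qclass I (\sum_(i <- r) F i) = \sum_(i <- r) qclass I (F i).
Proof. exact: (big_morph _ (@qclassD _ _ I) qclass0). Qed.

Lemma qscaleAl (c : K) x y : c *: (x * y) = (c *: x) * y.
Proof.
rewrite -[x]qreprK -[y]qreprK -qclassM -!qclassZ -qclassM.
by rewrite pathalg_scaleAl.
Qed.

Lemma qscaleAr (c : K) x y : c *: (x * y) = x * (c *: y).
Proof.
rewrite -[x]qreprK -[y]qreprK -qclassM -!qclassZ -qclassM.
by rewrite pathalg_scaleAr.
Qed.

Lemma alg_span (S : set A) : subspace S -> (forall q, S (pc q)) -> forall a, S a.
Proof.
move=> sS Spc a; rewrite -[a]qreprK [qrepr a]pathalgE qclass_sum.
by apply: subspace_sum => // q _; rewrite qclassZ; exact: subspaceZ sS (Spc q).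
Qed.

Lemma path_classM q p : pc q * pc p = oapp pc 0 (Defs.pcomp q p).
Proof.
rewrite /path_class -qclassM pbasisM.
by case: (Defs.pcomp q p) => //=; rewrite qclass0.
Qed.

Lemma path_classM_eq q p : pend p = pstart q ->
  exists r, [/\ pc q * pc p = pc r, pstart r = pstart p, pend r = pend q
              & parrows r = parrows p ++ parrows q].
Proof.
move=> pq; have [r er [rs ra]] := pcompP pq.
by exists r; rewrite path_classM er (pend_comp er).
Qed.

Lemma path_classM_neq q p : pend p <> pstart q -> pc q * pc p = 0.
Proof. by move=> pq; rewrite path_classM pcompN. Qed.

Lemma vertex_path v q : e v * pc q = if pend q == v then pc q else 0.
Proof. by rewrite path_classM pcomp_vl; case: eqP. Qed.

Lemma path_vertex v q : pc q * e v = if pstart q == v then pc q else 0.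
Proof. by rewrite path_classM pcomp_vr; case: eqP. Qed.

Lemma vertexM v w : e v * e w = if v == w then e w else 0.
Proof. by rewrite vertex_path /pend /= eq_sym. Qed.

Lemma vertex_idem v : e v * e v = e v.
Proof. by rewrite vertexM eqxx. Qed.

Lemma vertex_arrow v (a : arrow G) :
  e v * arrow_class I a = if tgt a == v then arrow_class I a else 0.
Proof. exact: vertex_path. Qed.

Lemma arrow_vertex v (a : arrow G) :
  arrow_class I a * e v = if src a == v then arrow_class I a else 0.
Proof. exact: path_vertex. Qed.

Lemma arrows_class_nil : arrows_class I [::] = 1.
Proof. by rewrite /arrows_class big_nil. Qed.

Lemma arrows_class_rcons s (a : arrow G) :
  arrows_class I (rcons s a) = arrow_class I a * arrows_class I s.
Proof. by rewrite /arrows_class rev_rcons big_cons. Qed.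

Lemma arrows_class_cat s1 s2 :
  arrows_class I (s1 ++ s2) = arrows_class I s2 * arrows_class I s1.
Proof. by rewrite /arrows_class rev_cat big_cat. Qed.

Lemma arrows_class_cons s (a : arrow G) :
  arrows_class I (a :: s) = arrows_class I s * arrow_class I a.
Proof. by rewrite -cat1s arrows_class_cat /arrows_class big_seq1. Qed.

(** Splitting off the last arrow, the shape needed for inductions that multiply
    on the left. *)
Lemma path_class_rcons q s (a : arrow G) : parrows q = rcons s a ->
  exists q', [/\ parrows q' = s, pstart q' = pstart q, pend q' = src a
               & pc q = arrow_class I a * pc q'].
Proof.
move=> qs; have := valP q; rewrite -[(val q).1]/(pstart q) -[(val q).2]/(parrows q).
rewrite qs -cats1 composable_cat /= andbT => /andP[cs /eqP ae].
pose q' : qpath G := exist _ (pstart q, s) cs.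
have q'e : pend q' = src a by [].
have [r [er rs _ ra]] := @path_classM_eq (apath a) q' q'e.
exists q'; split=> //; rewrite [RHS]er; congr pc; apply: qpath_inj; first by rewrite rs.
by rewrite ra qs cats1.
Qed.

Lemma path_classE q : pc q = arrows_class I (parrows q) * e (pstart q).
Proof.
move: {2}(parrows q) (erefl (parrows q)) => s; elim/last_ind: s q => [|s a IH] q qs.
  rewrite qs arrows_class_nil mul1r; congr pc.
  exact: qpath_inj.
have [q' [q's q'v _ ->]] := path_class_rcons qs.
by rewrite IH // q's q'v qs arrows_class_rcons mulrA.
Qed.

(** The span of the classes of the paths of length at least k, defined
    impredicatively so that membership is an induction principle. *)
Definition deg k : set A := [set a | forall S, subspace S ->
  (forall q, (k <= plength q)%N -> S (pc q)) -> S a].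

Lemma deg_subspace k : subspace (deg k).
Proof.
split=> [S [] //|c x y dx dy S sS h].
by case: (sS) => _; apply; [apply: dx|apply: dy].
Qed.

Lemma deg_path k q : (k <= plength q)%N -> deg k (pc q).
Proof. by move=> kq S sS; apply. Qed.

Lemma deg0 a : deg 0 a.
Proof. by apply: alg_span => [|q]; [exact: deg_subspace|exact: deg_path]. Qed.

Lemma degS k l a : (k <= l)%N -> deg l a -> deg k a.
Proof.
move=> kl da; apply: da => [|q lq]; first exact: deg_subspace.
by apply: deg_path; apply: leq_trans lq.
Qed.

Lemma degM k l x y : deg k x -> deg l y -> deg (k + l) (x * y).
Proof.
have [d0 dP] := deg_subspace (k + l).
move=> dx dy; apply: (dx [set x | deg (k + l) (x * y)]).
  split=> /= [|c a b da db]; first by rewrite mul0r.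
  by rewrite mulrDl -qscaleAl; apply: dP.
move=> q kq; apply: (dy [set y | deg (k + l) (pc q * y)]).
  split=> /= [|c a b da db]; first by rewrite mulr0.
  by rewrite mulrDr -qscaleAr; apply: dP.
move=> p lp /=; have [pq|pq] := pselect (pend p = pstart q).
  have [r [-> _ _ ra]] := path_classM_eq pq.
  by apply: deg_path; rewrite /plength ra size_cat addnC leq_add.
by rewrite path_classM_neq.
Qed.

Lemma deg_arrow (a : arrow G) : deg 1 (arrow_class I a).
Proof. exact: deg_path. Qed.

(** A path between distinct vertices is not trivial. *)
Lemma deg1_split v w a : v <> w -> deg 1 (e v * a * e w).
Proof.
move=> vw; have [d0 dP] := deg_subspace 1.
apply: (@alg_span [set a | deg 1 (e v * a * e w)]).
  split=> /= [|c x y dx dy]; first by rewrite mulr0 mul0r.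
  by rewrite mulrDr mulrDl -qscaleAr -qscaleAl; apply: dP.
move=> q /=; rewrite vertex_path; case: eqP => [qv|]; last by rewrite mul0r.
rewrite path_vertex; case: eqP => // qw; apply: deg_path.
rewrite lt0n; apply/eqP => /size0nil qn; apply: vw.
by rewrite -qv -qw /pend qn.
Qed.

Section Admissible.
Hypothesis admI : admissible I.

Let vertex_free : set (pathalg K G) :=
  [set f | forall v, pcoef (vpath v) f = 0].

Let pcoef_vertexM v (f g : pathalg K G) :
  pcoef (vpath v) (f * g) = pcoef (vpath v) f * pcoef (vpath v) g.
Proof.
rewrite [f in LHS]pathalgE [g in LHS]pathalgE mulr_suml linear_sum /=.
rewrite [f in RHS]pathalgE [g in RHS]pathalgE !linear_sum /= mulr_suml.
apply: eq_bigr => q _; rewrite mulr_sumr linear_sum mulr_sumr; apply: eq_bigr => p _.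
rewrite -pathalg_scaleAl -pathalg_scaleAr !linearZ /= !pcoef_basis pbasisM.
rewrite mulrACA -natrM mulnb -mulrA; congr (_ * (_ * _)).
have [/eqP pq|pq] := boolP (pend p == pstart q); last first.
  rewrite pcompN ?linear0; last exact/eqP.
  case: andP => // -[/eqP qv /eqP pv]; move: pq; rewrite qv pv /pend /=.
  by rewrite eqxx.
have [r er [rs ra]] := pcompP pq; rewrite er /= pcoef_basis; congr (_%:R).
congr nat_of_bool; apply/eqP/andP => [rv|[/eqP qv /eqP pv]]; last first.
  by apply: qpath_inj; rewrite ?rs ?ra ?qv ?pv.
have : parrows r = [::] by rewrite rv.
rewrite ra => /nilP; rewrite cat_nilp => /andP[/nilP pn /nilP qn].
have pv : pstart p = v by rewrite -rs rv.
have qv : pstart q = v by rewrite -pq /pend pn.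
by split; apply/eqP/qpath_inj.
Qed.

Let vertex_free_ideal : is_ideal vertex_free.
Proof.
split=> [v|f g hf hg v|f g hg v|f g hf v]; first by rewrite linear0.
- by rewrite linearB /= hf hg subrr.
- by rewrite pcoef_vertexM hg mulr0.
- by rewrite pcoef_vertexM hf mul0r.
Qed.

Let I_vertex_free f : ideal_set I f -> vertex_free f.
Proof.
case: admI => m m2 [_ I2] /I2.
have [V0 VB Vl Vr] := vertex_free_ideal.
case=> n [x [y [xA _ ->]]] v; rewrite linear_sum big1 //= => i _.
rewrite pcoef_vertexM.
have -> : pcoef (vpath v) (x i) = 0; last by rewrite mul0r.
apply: (xA i vertex_free vertex_free_ideal _ v) => a w; rewrite pcoef_basis.
by case: eqP => // /(congr1 (@parrows G)).
Qed.

(** The coefficient at the trivial path at v.  It does not depend on the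
    representative, because the ideal I is contained in the square of the arrow
    ideal. *)
Definition vcoef v a : K := pcoef (vpath v) (qrepr a).

Lemma vcoef_class v f : vcoef v (qclass I f) = pcoef (vpath v) f.
Proof.
apply/eqP; rewrite -subr_eq0 -linearB /=; apply/eqP.
exact/I_vertex_free/qreprE.
Qed.

Lemma vcoefP v c x y : vcoef v (c *: x + y) = c * vcoef v x + vcoef v y.
Proof.
rewrite -[x]qreprK -[y]qreprK -qclassZ -qclassD !vcoef_class.
by rewrite linearP.
Qed.

Lemma vcoefM v x y : vcoef v (x * y) = vcoef v x * vcoef v y.
Proof.
rewrite -[x]qreprK -[y]qreprK -qclassM !vcoef_class.
exact: pcoef_vertexM.
Qed.

Lemma vcoef0 v : vcoef v 0 = 0.
Proof. by rewrite -qclass0 vcoef_class linear0. Qed.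

Lemma vcoefD v x y : vcoef v (x + y) = vcoef v x + vcoef v y.
Proof. by have := vcoefP v 1 x y; rewrite !scale1r mul1r. Qed.

Lemma vcoef1 v : vcoef v 1 = 1.
Proof.
rewrite -qclass1 vcoef_class pathalg1E linear_sum (bigD1 v) //=.
rewrite pcoef_basis eqxx big1 ?addr0 // => w /eqP wv; rewrite pcoef_basis.
by case: eqP => // /(congr1 (@pstart G)) /wv.
Qed.

Lemma vcoef_decomp a : deg 1 (a - \sum_v vcoef v a *: e v).
Proof.
have sd := deg_subspace 1; have [d0 dP] := sd.
apply: (@alg_span [set a | deg 1 (a - \sum_v vcoef v a *: e v)]).
  split=> [|c x y dx dy] /=.
    by rewrite big1 ?subrr // => v _; rewrite vcoef0 scale0r.
  have -> : c *: x + y - \sum_v vcoef v (c *: x + y) *: e v =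
     c *: (x - \sum_v vcoef v x *: e v) + (y - \sum_v vcoef v y *: e v).
    rewrite scalerBr addrACA -opprD; congr (_ - _).
    rewrite scaler_sumr -big_split /=; apply: eq_bigr => v _.
    by rewrite vcoefP scalerDl scalerA.
  exact: dP.
move=> q /=; have [q0|q0] := posnP (plength q).
  have -> : q = vpath (pstart q) by apply: qpath_inj => //=; apply: size0nil.
  rewrite (bigD1 (pstart q)) //= big1 => [|v /eqP vq].
    by rewrite addr0 vcoef_class pcoef_basis eqxx scale1r subrr.
  rewrite vcoef_class pcoef_basis; case: eqP => [/(congr1 (@pstart G)) /esym /vq //|].
  by rewrite scale0r.
apply: (subspaceB sd); first exact: deg_path.
rewrite big1 // => v _; rewrite vcoef_class pcoef_basis.
by case: eqP => [qv|]; [move: q0; rewrite qv|rewrite scale0r].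
Qed.

(** The coefficient at v is a ring morphism to K, so its kernel is a maximal
    left ideal. *)
Lemma jacobson_vcoef a v : jacobson A a -> vcoef v a = 0.
Proof.
move=> Ja; apply: (Ja [set a : A^o | vcoef v a = 0]); split.
- split=> [|c x y]; first exact: vcoef0.
  by rewrite /= => hx hy; rewrite vcoefD vcoefM hx hy mulr0 addr0.
- move=> h; have /eqP : vcoef v 1 = 0.
    by have : [set: A^o] 1 by []; rewrite -h.
  by rewrite vcoef1 oner_eq0.
- move=> T [T0 TP] le; have [h|/existsNP[t /not_implyP[Tt /eqP t0]]] :=
    pselect (forall t, T t -> vcoef v t = 0).
    by left; apply/seteqP; split.
  right; apply/seteqP; split=> // y _.
  set c := vcoef v y / vcoef v t.
  have Ty : T (y - c *: (t : A)).
    by apply: le => /=; rewrite -scaleNr addrC vcoefP mulNr divfK // addNr.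
  have := TP (c *: (1 : A)) t _ Tt Ty.
  have -> : (c *: (1 : A)) *: (t : A^o) = c *: (t : A).
    by rewrite -[LHS]qscaleAl mul1r.
  by rewrite [_ + _]addrC subrK.
Qed.

Section Acyclic.
Hypothesis acyG : acyclic_quiver G.

Lemma pverts_uniq q : uniq (pverts q).
Proof.
rewrite /pverts; have := valP q; rewrite -[(val q).1]/(pstart q) -[(val q).2]/(parrows q).
elim: (parrows q) (pstart q) => // a s IH v /andP[av cs].
rewrite [map _ _]/= cons_uniq (IH _ cs) andbT -map_cons; apply/mapP => -[b bs vb].
have [s1 [s2 es]] : exists s1 s2, a :: s = rcons s1 b ++ s2.
  by case/splitPr: bs => s1 s2; exists s1, s2; rewrite cat_rcons.
have c1 : composable v (rcons s1 b).
  have : composable v (a :: s) by rewrite /= av.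
  by rewrite es composable_cat => /andP[].
case: (@acyG (exist _ (v, rcons s1 b) c1)) => /=; first by rewrite /plength /= size_rcons.
by rewrite /pend /= map_rcons last_rcons.
Qed.

Lemma plength_bound q : (plength q < #|vertex G|)%N.
Proof.
have /card_uniqP e := pverts_uniq q.
by rewrite -[X in (X < _)%N](size_map (@tgt G)) -[X in (X <= _)%N]e max_card.
Qed.

(** The vertices of a path are distinct, so paths are shorter than the number
    of vertices. *)
Lemma deg_nilp k a : (#|vertex G| <= k)%N -> deg k a -> a = 0.
Proof.
move=> kN da; apply: (da [set a | a = 0]) => [|q kq].
  by split=> // c x y /= -> ->; rewrite scaler0 addr0.
by have := leq_trans kN kq; rewrite leqNgt plength_bound.
Qed.

(** If a maximal left ideal L did not contain a, then 1 = b a + l for some l in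
    L; but b a is nilpotent, so l = 1 - b a has a left inverse. *)
Lemma deg1_jacobson a : deg 1 a -> jacobson A a.
Proof.
move=> da L [[L0 LP] Lneq Lmax]; apply: contrapT => nLa.
pose T : set A^o := [set x | exists b l, L l /\ x = b * a + l].
have T1 : T 1.
  have [||TL|->] // := Lmax T.
  - split; first by exists 0, 0; rewrite mul0r add0r.
    move=> c x y [b [l [Ll ->]]] [b' [l' [Ll' ->]]].
    exists (c * b + b'), (c *: l + l'); split; first exact: LP.
    change (c * (b * a + l) + (b' * a + l') = (c * b + b') * a + (c * l + l')).
    by rewrite mulrDr mulrDl mulrA addrACA.
  - by move=> l Ll; exists 0, l; rewrite mul0r add0r.
  - by case: nLa; rewrite -TL; exists 1, 0; rewrite mul1r addr0.
have [b [l [Ll l1]]] := T1.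
have dba : deg 1 (b * a) := degM (deg0 b) da.
have inv n : exists c : A, c * (1 - b * a) = 1 - (b * a) ^+ n.
  elim: n => [|n [c hc]]; first by exists 0; rewrite mul0r expr0 subrr.
  by exists (c + (b * a) ^+ n); rewrite mulrDl hc mulrBr mulr1 exprSr addrA subrK.
have dX n : deg n ((b * a) ^+ n).
  by elim: n => [|n IH]; [exact: deg0|rewrite exprS; exact: degM dba IH].
have [c] := inv #|vertex G|; rewrite (deg_nilp _ (dX _)) // subr0.
rewrite {1}l1 addrC addKr => cl.
case: Lneq; apply/seteqP; split=> // y _.
have := LP (y * c) l 0 Ll L0; rewrite addr0.
by rewrite -[_ *: _]/(y * c * l) -mulrA cl mulr1.
Qed.

Lemma jacobsonE a : jacobson A a <-> deg 1 a.
Proof.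
split=> [Ja|]; last exact: deg1_jacobson.
have := vcoef_decomp a; rewrite big1 ?subr0 // => v _.
by rewrite jacobson_vcoef ?scale0r.
Qed.

Lemma jacobsonMr a x : jacobson A x -> jacobson A (x * a).
Proof. by rewrite !jacobsonE => dx; rewrite -[1%N]addn0; apply: degM => //; exact: deg0. Qed.

Lemma jacobson_subspace : subspace (jacobson A).
Proof.
have [d0 dP] := deg_subspace 1.
by split=> [|c x y]; rewrite !jacobsonE //; apply: dP.
Qed.

Lemma sumset_subspace (X Y : set A) : subspace X ->
  subspace (sumset *%R X Y : set A).
Proof.
move=> sX; split; first by exists 0%N, (fun=> 0), (fun=> 0); split=> [[]|[]|] //; rewrite big_ord0.
move=> c x y [m [f [g [fX gY ->]]]] [n [f' [g' [fX' gY' ->]]]].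
exists (m + n)%N.
exists (fun i => match fintype.split i with inl j => c *: f j | inr k => f' k end).
exists (fun i => match fintype.split i with inl j => g j | inr k => g' k end).
split=> [i|i|]; try by case: (fintype.split i) => j //; apply: subspaceZ.
rewrite big_split_ord /= scaler_sumr; congr (_ + _); apply: eq_bigr => i _.
  by rewrite (unsplitK (inl i)) qscaleAl.
by rewrite (unsplitK (inr i)).
Qed.

Lemma jacobson2E a : ideal_exp (jacobson A) 2 a <-> deg 2 a.
Proof.
split=> [[n [x [y [xJ yJ ->]]]]|].
  apply: subspace_sum => [|i _]; first exact: deg_subspace.
  apply: (@degM 1 1); first exact/jacobsonE.
  have [m [x' [y' [xJ' _ ->]]]] := yJ i.
  apply: subspace_sum => [|j _]; first exact: deg_subspace.
  by apply: (@degM 1 0); [exact/jacobsonE|exact: deg0].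
move=> da; apply: da => [|q]; first exact: sumset_subspace jacobson_subspace.
rewrite /plength; case/lastP qs: (parrows q) => [|s b] //.
rewrite size_rcons ltnS => s0.
have [q' [q's _ _ ->]] := path_class_rcons qs.
exists 1%N, (fun=> arrow_class I b), (fun=> pc q').
split=> [_|_|]; last by rewrite big_ord1.
  by apply/jacobsonE; apply: deg_arrow.
exists 1%N, (fun=> pc q'), (fun=> 1); split=> //; last by rewrite big_ord1 mulr1.
by move=> _; apply/jacobsonE; apply: deg_path; rewrite /plength q's.
Qed.

(** A nontrivial path from the end of q to its start would close a directed
    cycle with q. *)
Lemma reach_jacobson0 q a : jacobson A a -> e (pstart q) * a * e (pend q) = 0.
Proof.
move/jacobsonE=> da.
apply: (da [set a | e (pstart q) * a * e (pend q) = 0]) => [|p p1 /=].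
  split=> [|c x y /= hx hy]; first by rewrite /= mulr0 mul0r.
  by rewrite mulrDr mulrDl -qscaleAr -qscaleAl hx hy scaler0 addr0.
rewrite vertex_path; case: eqP => [pq|]; last by rewrite mul0r.
rewrite path_vertex; case: eqP => // qp; case: (pcompP pq) => r er [rs ra].
case: (@acyG r); first by rewrite /plength ra size_cat ltn_addr.
by rewrite (pend_comp er) rs.
Qed.

Lemma vertex_jacobson0 v a : jacobson A a -> e v * a * e v = 0.
Proof. exact: (reach_jacobson0 (vpath v)). Qed.

Lemma vertex_corner v a : e v * a * e v = vcoef v a *: e v.
Proof.
have /jacobsonE/(vertex_jacobson0 v)/eqP := vcoef_decomp a.
rewrite mulrBr mulrBl subr_eq0 => /eqP ->.
rewrite (bigD1 v) //= mulrDr mulrDl mulr_sumr mulr_suml big1 => [|w wv].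
  by rewrite addr0 -qscaleAr -qscaleAl !vertex_idem.
by rewrite -qscaleAr -qscaleAl vertexM eq_sym (negbTE wv) mul0r scaler0.
Qed.

Lemma vertex_diff_jacobson v w a : v <> w -> jacobson A (e v * a * e w).
Proof. by move=> vw; apply/jacobsonE; apply: deg1_split. Qed.

Lemma alg_finite : exists s : seq A, forall S : set A, subspace S ->
  (forall x, x \in s -> S x) -> forall a, S a.
Proof.
have fin k : exists s : seq A, forall q, plength q = k -> pc q \in s.
  elim: k => [|k [s hs]].
    exists [seq e v | v <- enum (vertex G)] => q /size0nil q0.
    have -> : q = vpath (pstart q) by apply: qpath_inj.
    by apply/mapP; exists (pstart q); rewrite ?mem_enum.
  exists [seq arrow_class I (g : arrow G) * x | g <- enum (arrow G), x <- s] => q.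
  rewrite /plength; case/lastP qs: (parrows q) => [|r a] //.
  rewrite size_rcons => -[sk]; have [q' [q's _ _ ->]] := path_class_rcons qs.
  apply/allpairsP; exists (a, pc q'); split; rewrite ?mem_enum //=.
  by apply: hs; rewrite /plength q's.
have [s hs] : exists s : seq A, forall q, (plength q < #|vertex G|)%N -> pc q \in s.
  elim: #|vertex G| => [|k [s hs]]; first by exists [::].
  have [s' hs'] := fin k; exists (s ++ s') => q; rewrite ltnS leq_eqVlt mem_cat.
  by case/orP=> [/eqP/hs' ->|/hs ->] //; rewrite orbT.
exists s => S sS hS; apply: alg_span => // q; apply/hS/hs.
exact: plength_bound.
Qed.

End Acyclic.
End Admissible.

(** Restriction of scalars to K. *)
Definition restr (X : lmodType A) : Type := X.

Section Restr.
Variable X : lmodType A.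
HB.instance Definition _ := GRing.Zmodule.on (restr X).
Definition restr_scale (c : K) (u : restr X) : restr X := (c *: (1 : A)) *: (u : X).
Lemma restr_scaleA c d u : restr_scale c (restr_scale d u) = restr_scale (c * d) u.
Proof. by rewrite /restr_scale scalerA -qscaleAl mul1r scalerA. Qed.
Lemma restr_scale1 : left_id 1 restr_scale.
Proof. by move=> u; rewrite /restr_scale !scale1r. Qed.
Lemma restr_scaleDr : right_distributive restr_scale +%R.
Proof. by move=> c u t; rewrite /restr_scale scalerDr. Qed.
Lemma restr_scaleDl u : {morph restr_scale^~ u : c d / c + d}.
Proof. by move=> c d; rewrite /restr_scale !scalerDl. Qed.
HB.instance Definition _ := GRing.Zmodule_isLmodule.Build K (restr X)
  restr_scaleA restr_scale1 restr_scaleDr restr_scaleDl.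

Lemma restrE (c : K) (u : X) : c *: (u : restr X) = (c *: (1 : A)) *: u.
Proof. by []. Qed.

End Restr.

End PathClasses.

(** * The mast and its parts *)

Section Subpaths.
Variables (G : quiver) (p : qpath G).

Definition vert i : vertex G := nth (pstart p) (pverts p) i.

Lemma size_pverts : size (pverts p) = (plength p).+1.
Proof. by rewrite /= size_map. Qed.

Lemma vert_mem i : (i <= plength p)%N -> vert i \in pverts p.
Proof. by move=> il; rewrite mem_nth // size_pverts. Qed.

Lemma vertP v : v \in pverts p -> exists2 i, (i <= plength p)%N & v = vert i.
Proof.
move=> vp; exists (index v (pverts p)); last by rewrite /vert nth_index.
by rewrite -ltnS -size_pverts index_mem.
Qed.

Lemma vert0 : vert 0 = pstart p.
Proof. by []. Qed.

Lemma vert_size s1 s2 : parrows p = s1 ++ s2 ->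
  vert (size s1) = last (pstart p) (map (@tgt G) s1).
Proof.
move=> es; rewrite /vert /pverts es map_cat -cat_cons nth_cat /= size_map ltnS leqnn.
by rewrite [RHS](last_nth (pstart p)) size_map.
Qed.

Lemma subpath s1 s2 s3 : parrows p = s1 ++ s2 ++ s3 ->
  exists q : qpath G, [/\ pstart q = vert (size s1), parrows q = s2
                        & pend q = vert (size s1 + size s2)].
Proof.
move=> es; have := valP p; rewrite -[(val p).1]/(pstart p) -[(val p).2]/(parrows p).
rewrite es !composable_cat => /and3P[_ c2 _].
exists (exist _ (last (pstart p) (map (@tgt G) s1), s2) c2); split=> //.
  by rewrite (vert_size es).
rewrite -size_cat (@vert_size (s1 ++ s2) s3); last by rewrite -catA.
by rewrite map_cat last_cat.
Qed.

Lemma subpath_between i j : (i <= j <= plength p)%N ->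
  exists q : qpath G, [/\ pstart q = vert i, parrows q = drop i (take j (parrows p))
                        & pend q = vert j].
Proof.
move=> /andP[ij jl].
have e : parrows p = take i (take j (parrows p)) ++
    drop i (take j (parrows p)) ++ drop j (parrows p).
  by rewrite catA !cat_take_drop.
have st : size (take j (parrows p)) = j by rewrite size_takel.
have si : size (take i (take j (parrows p))) = i by rewrite size_takel ?st.
have [q [qs qa qe]] := subpath e; exists q; split=> //; first by rewrite qs si.
by rewrite qe si size_drop st subnKC.
Qed.

Lemma mast_arrow_ends s1 (a : arrow G) s2 : parrows p = s1 ++ a :: s2 ->
  src a = vert (size s1) /\ tgt a = vert (size s1).+1.
Proof.
move=> es; split.
  have [|q [qs qa _]] := @subpath s1 [:: a] s2; first by [].
  have := valP q; rewrite -[(val q).1]/(pstart q) -[(val q).2]/(parrows q) qs qa.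
  by rewrite /= andbT => /eqP.
rewrite /vert /pverts es /= map_cat nth_cat size_map ltnn subnn.
by [].
Qed.

Hypothesis acyG : acyclic_quiver G.

Lemma index_vert i : (i <= plength p)%N -> index (vert i) (pverts p) = i.
Proof. by move=> il; rewrite index_uniq ?size_pverts // pverts_uniq. Qed.

Lemma vert_inj i j : (i <= plength p)%N -> (j <= plength p)%N ->
  (vert i == vert j) = (i == j).
Proof. by move=> il jl; rewrite nth_uniq ?size_pverts // pverts_uniq. Qed.

Lemma arrow_increasing (a : arrow G) i j : (i <= plength p)%N -> (j <= plength p)%N ->
  src a = vert i -> tgt a = vert j -> (i < j)%N.
Proof.
move=> il jl ai aj; rewrite ltnNge; apply/negP => ji.
have [|q [qs _ qe]] := @subpath_between j i; first by rewrite ji.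
have aq : pend (apath a) = pstart q by rewrite qs -aj.
have [r er [rs ra]] := pcompP aq.
apply: (acyG (p := r)); first by rewrite /plength ra size_cat.
by rewrite (pend_comp er) rs qe -ai.
Qed.

End Subpaths.

Section MastClasses.
Variables (K : fieldType) (G : quiver) (I : ideal (pathalg K G)) (p : qpath G).
Local Notation A := (quotalg I).
Local Notation e v := (path_class I (vpath v)).
Local Notation P := (path_class I p).
Local Notation l := (plength p).
Local Notation vt := (vert p).

(** The idempotent makes the factors homogeneous also for the trivial path,
    where [mast_from] and [mast_to] are 1. *)
Definition mfrom i : A := arrows_class I (drop i (parrows p)) * e (vt i).
Definition mto i : A := arrows_class I (take i (parrows p)) * e (vt 0).

Lemma mfrom_path i : (i <= l)%N ->
  exists q : qpath G, [/\ mfrom i = path_class I q, pstart q = vt i & pend q = vt l].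
Proof.
move=> il; have [|q [qs qa qe]] := @subpath_between G p i l; first by rewrite il leqnn.
by exists q; split=> //; rewrite [path_class I q]path_classE qs qa take_oversize.
Qed.

Lemma mto_path i : (i <= l)%N ->
  exists q : qpath G, [/\ mto i = path_class I q, pstart q = vt 0 & pend q = vt i].
Proof.
move=> il; have [//|q [qs qa qe]] := @subpath_between G p 0 i.
by exists q; split=> //; move: qa; rewrite [path_class I q]path_classE qs drop0 => ->.
Qed.

Lemma mfrom_l i : (i <= l)%N -> e (vt l) * mfrom i = mfrom i.
Proof. by case/mfrom_path=> q [-> _ qe]; rewrite vertex_path qe eqxx. Qed.

Lemma mfrom_r i : mfrom i * e (vt i) = mfrom i.
Proof. by rewrite /mfrom -mulrA vertex_idem. Qed.

Lemma mto_l i : (i <= l)%N -> e (vt i) * mto i = mto i.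
Proof. by case/mto_path=> q [-> _ qe]; rewrite vertex_path qe eqxx. Qed.

Lemma mto_r i : mto i * e (vt 0) = mto i.
Proof. by rewrite /mto -mulrA vertex_idem. Qed.

Lemma mto0 : mto 0 = e (vt 0).
Proof. by rewrite /mto take0 arrows_class_nil mul1r. Qed.

Lemma mtol : mto l = P.
Proof. by rewrite /mto [path_class I p]path_classE take_size. Qed.

Lemma mfrom0 : mfrom 0 = P.
Proof. by rewrite /mfrom [path_class I p]path_classE drop0. Qed.

Lemma mfroml : mfrom l = e (vt l).
Proof. by rewrite /mfrom drop_size arrows_class_nil mul1r. Qed.

Lemma path_r : P * e (vt 0) = P.
Proof. by rewrite -mtol mto_r. Qed.

Lemma path_l : e (vt l) * P = P.
Proof. by rewrite -mfrom0 mfrom_l. Qed.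

Lemma mfrom_mto i : (i <= l)%N -> mfrom i * mto i = P.
Proof.
move=> il; rewrite /mfrom -mulrA mto_l // /mto mulrA -arrows_class_cat cat_take_drop.
by rewrite [RHS]path_classE.
Qed.

Lemma mast_arrowP s1 (a : arrow G) s2 : parrows p = s1 ++ a :: s2 ->
  mto (size s1).+1 = arrow_class I a * mto (size s1) /\
  mfrom (size s1) = mfrom (size s1).+1 * arrow_class I a.
Proof.
move=> es; have [as1 at1] := mast_arrow_ends es; split.
  rewrite /mto es [take (size s1) _]take_size_cat // take_cat ltnNge leqnSn /= subSnn /= take0.
  by rewrite cats1 arrows_class_rcons mulrA.
rewrite /mfrom es [drop (size s1) _]drop_size_cat // drop_cat ltnNge leqnSn /= subSnn /= drop0.
by rewrite arrows_class_cons -!mulrA arrow_vertex as1 eqxx vertex_arrow at1 eqxx.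
Qed.

Lemma mast_arrow (a : arrow G) : a \in parrows p -> exists i, [/\ (i < l)%N,
  src a = vt i, tgt a = vt i.+1, mto i.+1 = arrow_class I a * mto i &
  mfrom i = mfrom i.+1 * arrow_class I a].
Proof.
move=> ap; have [s1 [s2 es]] : exists s1 s2, parrows p = s1 ++ a :: s2.
  by case/splitPr: ap => s1 s2; exists s1, s2.
exists (size s1).
have [-> ->] := mast_arrow_ends es; have [<- <-] := mast_arrowP es.
by split=> //; rewrite /plength es size_cat /= addnS ltnS leq_addr.
Qed.

Lemma mast_arrow_nth i : (i < l)%N -> exists2 a : arrow G, src a = vt i &
  mto i.+1 = arrow_class I a * mto i.
Proof.
move=> il; have es := cat_take_drop i (parrows p).
case ed: (drop i (parrows p)) => [|a s].
  by have := size_drop i (parrows p); rewrite ed => /esym/eqP; rewrite subn_eq0 leqNgt il.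
rewrite ed in es; have [h _] := mast_arrow_ends (esym es).
have [h' _] := mast_arrowP (esym es); move: h h'; rewrite size_takel; last exact: ltnW.
by exists a.
Qed.

Section Literal.
Hypothesis acyG : acyclic_quiver G.

(** The idempotent is absorbed as soon as the part of the mast has an arrow. *)
Lemma mast_to_mto i : (0 < i <= l)%N -> mast_to I p (vt i) = mto i.
Proof.
move=> /andP[i0 il]; rewrite /mast_to index_vert // /mto.
case: i i0 il => // i _; rewrite /plength.
case es: (parrows p) => [//|a s] _; rewrite take_cons arrows_class_cons -mulrA.
have [<- _] := @mast_arrow_ends G p [::] a s es.
by rewrite arrow_vertex eqxx.
Qed.

Lemma mast_from_mfrom i : (i < l)%N -> mast_from I p (vt i) = mfrom i.
Proof.
move=> il; rewrite /mast_from index_vert 1?ltnW // /mfrom.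
have es := cat_take_drop i (parrows p).
case ed: (drop i (parrows p)) => [|a s].
  by have := size_drop i (parrows p); rewrite ed => /esym/eqP; rewrite subn_eq0 leqNgt il.
rewrite ed in es; have [h _] := mast_arrow_ends (esym es).
move: h; rewrite size_takel; last exact: ltnW.
by move=> h; rewrite arrows_class_cons -mulrA arrow_vertex h eqxx.
Qed.

Lemma arrow_mast_to (a : arrow G) i : (i <= l)%N -> src a = vt i ->
  arrow_class I a * mast_to I p (src a) = arrow_class I a * mto i.
Proof.
move=> il ai; rewrite ai; have [i0|i0] := posnP i; last by rewrite mast_to_mto // i0.
rewrite i0 /mast_to index_vert // take0 arrows_class_nil mulr1 mto0.
by rewrite arrow_vertex ai i0 eqxx.
Qed.

End Literal.
End MastClasses.

(** * The basis of U given by the mast *)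

Section Scalars.
Variables (K : fieldType) (G : quiver) (I : ideal (pathalg K G)).
Local Notation A := (quotalg I).

(** Scalars as elements of A, so that they act on every A-module. *)
Definition sc (c : K) : A := c *: (1 : A).

Lemma scE c (a : A) : c *: a = sc c * a.
Proof. by rewrite -qscaleAl mul1r. Qed.

Lemma scC c (a : A) : a * sc c = sc c * a.
Proof. by rewrite -qscaleAr mulr1 scE. Qed.

Lemma sc0 : sc 0 = 0. Proof. exact: scale0r. Qed.
Lemma sc1 : sc 1 = 1. Proof. exact: scale1r. Qed.
Lemma scD c d : sc (c + d) = sc c + sc d. Proof. exact: scalerDl. Qed.
Lemma scN c : sc (- c) = - sc c. Proof. exact: scaleNr. Qed.
Lemma scM c d : sc (c * d) = sc c * sc d.
Proof. by rewrite -scE scalerA. Qed.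

Lemma scV c : c != 0 -> sc c^-1 * sc c = 1.
Proof. by move=> c0; rewrite -scM mulVf // sc1. Qed.

Variable X : lmodType A.

Lemma sc_scaleC c (a : A) (x : X) : a *: (sc c *: x) = sc c *: (a *: x).
Proof. by rewrite !scalerA scC. Qed.

Lemma sc_eq0 c (x : X) : sc c *: x = 0 -> x <> 0 -> c = 0.
Proof.
move=> cx x0; apply/eqP; apply: contra_notT x0 => c0.
by rewrite -[x]scale1r -(scV c0) -scalerA cx scaler0.
Qed.

End Scalars.

Section UniserialModule.
Variables (K : fieldType) (G : quiver) (I : ideal (pathalg K G)).
Hypotheses (admI : admissible I) (acyG : acyclic_quiver G).
Variables (p : qpath G) (U : lmodType (quotalg I)).
Local Notation A := (quotalg I).
Local Notation e v := (path_class I (vpath v)).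
Local Notation P := (path_class I p).
Local Notation l := (plength p).
Local Notation vt := (vert p).
Local Notation F := (mfrom I p).
Local Notation T := (mto I p).
Local Notation J := (jacobson A).
Local Notation sc := (@sc K G I).

Section SimpleFactors.
Variables S0 S1 : set U.
Hypotheses (sub0 : submodule S0) (sub1 : submodule S1) (fac : simple_factor S0 S1).

(** The submodule generated by S0 and the products of elements of degree at
    least k with elements of S1. *)
Let sub_gen k : set U := [set y | forall Y : set U, submodule Y -> S0 `<=` Y ->
  (forall a z, deg k a -> S1 z -> Y (a *: z)) -> Y y].

Let sub_gen_sub k : submodule (sub_gen k).
Proof.
split=> [Y [] //|a x y hx hy Y sY h1 h2].
by case: (sY) => _; apply; [apply: hx|apply: hy].
Qed.

(** Nakayama's lemma for a simple factor: were S1 = S0 + J S1, iterating would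
    give S1 = S0, as the elements of large degree are zero. *)
Lemma factor_radical a z : J a -> S1 z -> S0 (a *: z).
Proof.
case: fac => [le neq mx] /(jacobsonE admI acyG) da S1z.
have in0 k : S0 `<=` sub_gen k by move=> x S0x Y _ le0 _; apply: le0.
have inJ k b y : deg k b -> S1 y -> sub_gen k (b *: y).
  by move=> db S1y Y _ _ h; apply: h.
have le1 : sub_gen 1 `<=` S1.
  move=> y hy; apply: (hy S1 sub1 le) => b x _ S1x; case: sub1 => S10 S1P.
  by rewrite -[_ *: _]addr0; apply: S1P.
have [<-|eq1] := mx _ (sub_gen_sub 1) (in0 1%N) le1; first exact: inJ.
have all k : S1 `<=` sub_gen k.
  elim: k => [|k IH] y S1y.
    by rewrite -[y]scale1r; apply: inJ => //; exact: deg0.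
  rewrite -eq1 in S1y.
  apply: (S1y _ (sub_gen_sub k.+1) (in0 k.+1)) => b x db /IH Hx.
  have [g0 gP] := sub_gen_sub k.+1.
  pose Y : set U := [set t | forall b, deg 1 b -> sub_gen k.+1 (b *: t)].
  apply: (Hx Y) => // [|t S0t b' _|b' z' db' S1z' b'' db''].
  - split=> [b' _|c t t' ht ht' b' db']; first by rewrite scaler0.
    have := gP 1 _ _ (ht (b' * c) _) (ht' b' db'); rewrite scale1r scalerDr scalerA.
    by apply; rewrite -[1%N]addn0; apply: degM => //; exact: deg0.
  - by apply: in0; case: sub0 => S00 S0P; rewrite -[_ *: _]addr0; apply: S0P.
  - by rewrite scalerA; apply: inJ => //; apply: (degM db'' db').
case: neq; apply/seteqP; split=> // y /(all #|vertex G|) hy.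
apply: (hy S0 sub0) => // b x db _.
by rewrite (deg_nilp acyG _ db) // scale0r; case: sub0.
Qed.

(** Modulo J, an element of A acts on a vector of e_v U as a scalar, so the
    simple factor is one-dimensional. *)
Lemma factor_line v y z : e v *: y = y -> S1 y -> ~ S0 y -> S1 z ->
  exists c, S0 (z - sc c *: y).
Proof.
move=> vy S1y nS0y S1z; case: fac => [le neq mx].
case: (sub0) (sub1) => [S00 S0P] [S10 S1P].
pose Y : set U := [set z | exists c, S0 (z - sc c *: y)].
have S0Y : S0 `<=` Y by move=> x S0x; exists 0; rewrite sc0 scale0r subr0.
have ay a : exists c, S0 (a *: y - sc c *: y).
  exists (vcoef v a); have := vcoef_decomp admI a.
  move=> /(jacobsonE admI acyG) /factor_radical - /(_ y S1y).
  rewrite scalerBl scaler_suml (bigD1 v) //= big1 => [|w /negbTE wv].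
    by rewrite addr0 scE -scalerA vy.
  by rewrite scE -vy !scalerA -mulrA vertexM wv mulr0 scale0r.
have subY : submodule Y.
  split; first exact: S0Y.
  move=> a x x' [c hc] [c' hc'].
  have [d hd] := ay (a * sc c); exists (d + c').
  have -> : a *: x + x' - sc (d + c') *: y = a *: (x - sc c *: y) +
     (1 *: ((a * sc c) *: y - sc d *: y) + (x' - sc c' *: y)).
    rewrite scale1r scD scalerDl scalerBr scalerA opprD !addrA subrK.
    by rewrite -!addrA; congr (_ + _); rewrite !addrA [- _ + x']addrC.
  by apply: (S0P) => //; apply: S0P.
have leY : Y `<=` S1.
  move=> x [c hc]; rewrite -[x](subrK (sc c *: y)) addrC.
  by apply: S1P => //; apply: le.
have [eqY|eqY] := mx Y subY S0Y leY; last by rewrite -eqY in S1z.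
by case: nS0y; rewrite -eqY; exists 1; rewrite sc1 scale1r subrr.
Qed.

End SimpleFactors.

Variable x0 : U.
Hypotheses (Px0 : P *: x0 <> 0) (lenU : module_length U l.+1).

Definition top : U := e (vt 0) *: x0.
Definition bas i : U := T i *: top.

Lemma bas0 : bas 0 = top.
Proof. by rewrite /bas mto0 /top scalerA vertex_idem. Qed.

Lemma basl_neq0 : bas l <> 0.
Proof. by rewrite /bas /top mtol scalerA path_r. Qed.

Lemma bas_vertex i : (i <= l)%N -> e (vt i) *: bas i = bas i.
Proof. by move=> il; rewrite /bas scalerA mto_l. Qed.

Lemma bas_vertex_neq v i : (i <= l)%N -> v <> vt i -> e v *: bas i = 0.
Proof.
move=> il /eqP vi; rewrite -(bas_vertex il) scalerA vertexM (negbTE vi).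
by rewrite scale0r.
Qed.

Lemma mfrom_bas i : (i <= l)%N -> F i *: bas i = bas l.
Proof. by move=> il; rewrite /bas scalerA mfrom_mto // mtol. Qed.

(** In a composition series S of length l + 1, multiplication by an arrow goes
    one step down.  Hence bas i lies in S (l + 1 - i), but not one step lower,
    since from there the rest of the mast would lead to bas l in S 0 = 0.  So
    the bas i represent the one-dimensional factors. *)
Lemma bas_span u : exists c : 'I_l.+1 -> K, u = \sum_i sc (c i) *: bas i.
Proof.
have [s [s0 sl ssub sfac] ss] := lenU.
pose S i := nth set0 s i.
have S0 : S 0%N = [set 0] by rewrite /S nth0.
have SU : S l.+1 = setT by rewrite -sl -nth_last ss.
have sub i : (i <= l.+1)%N -> submodule (S i) by move=> il; apply: ssub; rewrite ss.
have fac i : (i <= l)%N -> simple_factor (S i) (S i.+1).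
  by move=> il; apply: sfac; rewrite ss ltnS.
have rad i a z : (i <= l)%N -> J a -> S i.+1 z -> S i (a *: z).
  by move=> il; apply: factor_radical; [apply: sub; exact: leqW|exact: sub|exact: fac].
have bS i : (i <= l)%N -> S (l.+1 - i)%N (bas i).
  elim: i => [|i IH] il; first by rewrite subn0 SU.
  have [a _ Ta] := mast_arrow_nth I il.
  rewrite /bas Ta -scalerA subSS; apply: rad; first exact: leq_subr.
    by apply/(jacobsonE admI acyG); exact: deg_arrow.
  by rewrite -subSn ?(ltnW il) //; apply: IH; exact: ltnW.
have bN i : (i <= l)%N -> ~ S (l - i)%N (bas i).
  move=> il h; have : forall k, (i + k <= l)%N -> S (l - (i + k))%N (bas (i + k)).
    elim=> [|k IH] kl; first by rewrite addn0.
    have kl' : (i + k < l)%N by rewrite addnS in kl.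
    have [a _ Ta] := mast_arrow_nth I kl'.
    rewrite addnS /bas Ta -scalerA; apply: rad; first exact: leq_subr.
      by apply/(jacobsonE admI acyG); exact: deg_arrow.
    by rewrite subnSK //; apply: IH; exact: ltnW.
  move=> /(_ (l - i)%N); rewrite subnKC // leqnn subnn S0.
  by move=> /(_ isT); exact: basl_neq0.
have span k : (k <= l.+1)%N -> forall u, S k u ->
    exists c : 'I_l.+1 -> K, u = \sum_i sc (c i) *: bas i.
  elim: k => [|k IH] kl {}u.
    rewrite S0 => ->; exists (fun=> 0); rewrite big1 // => i _.
    by rewrite sc0 scale0r.
  move=> Sku; have li : (l - k <= l)%N by exact: leq_subr.
  have lk : (l - (l - k) = k)%N by rewrite subKn.
  have bk := bS _ li; have nbk := bN _ li; rewrite subSn // lk in bk.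
  rewrite lk in nbk.
  have [c hc] := factor_line (sub k (ltnW kl)) (sub k.+1 kl) (fac k kl)
    (bas_vertex li) bk nbk Sku.
  have [d ud] := IH (ltnW kl) _ hc.
  exists (fun i => d i + (if i == inord (l - k) then c else 0)).
  under eq_bigr do rewrite scD scalerDl.
  rewrite big_split /= -ud (bigD1 (inord (l - k))) //= eqxx inordK ?ltnS //.
  rewrite big1 ?addr0 ?subrK // => i /negbTE ->.
  by rewrite sc0 scale0r.
by apply: (span l.+1) => //; rewrite SU.
Qed.

Lemma last_vertex_line u : exists c, e (vt l) *: u = sc c *: bas l.
Proof.
have [c ->] := bas_span u; exists (c ord_max); rewrite scaler_sumr.
rewrite (bigD1 ord_max) //= sc_scaleC bas_vertex // big1 ?addr0 // => i im.
have il : (i <= l)%N by rewrite -ltnS.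
rewrite sc_scaleC bas_vertex_neq ?scaler0 //.
by apply/eqP; rewrite vert_inj // eq_sym.
Qed.

(** The last coordinate: e (vt l) *: u is a multiple of the socle vector bas l. *)
Definition xi (u : U) : K := xget 0 [set c | e (vt l) *: u = sc c *: bas l].

Lemma xiE u : e (vt l) *: u = sc (xi u) *: bas l.
Proof.
have [c hc] := last_vertex_line u.
apply: (@xgetPex _ (0 : K) [set c | e (vt l) *: u = sc c *: bas l]).
by exists c. Qed.

Lemma xi_uniq u c : e (vt l) *: u = sc c *: bas l -> xi u = c.
Proof.
move=> hc; apply/eqP; rewrite -subr_eq0; apply/eqP.
apply: (@sc_eq0 _ _ _ _ _ (bas l)); last exact: basl_neq0.
by rewrite scD scN scalerBl -xiE hc subrr.
Qed.

Lemma xiP c u t : xi (sc c *: u + t) = c * xi u + xi t.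
Proof.
apply: xi_uniq; rewrite scalerDr sc_scaleC !xiE scD scM scalerDl.
by rewrite !scalerA.
Qed.

Lemma xi0 : xi 0 = 0.
Proof. by apply: xi_uniq; rewrite scaler0 sc0 scale0r. Qed.

Lemma xiZ c u : xi (sc c *: u) = c * xi u.
Proof. by have := xiP c u 0; rewrite !addr0 xi0 addr0. Qed.

Lemma xiD u t : xi (u + t) = xi u + xi t.
Proof. by have := xiP 1 u t; rewrite sc1 scale1r mul1r. Qed.

Lemma xiN u : xi (- u) = - xi u.
Proof. by have := xiZ (-1) u; rewrite scN sc1 scaleN1r mulN1r. Qed.

Lemma xi_bas : xi (bas l) = 1.
Proof. by apply: xi_uniq; rewrite bas_vertex // sc1 scale1r. Qed.

Lemma mfrom_xi i u : (i <= l)%N -> F i *: u = sc (xi (F i *: u)) *: bas l.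
Proof. by move=> il; rewrite -xiE scalerA mfrom_l. Qed.

Lemma bas_decomp u : u = \sum_(i < l.+1) sc (xi (F i *: u)) *: bas i.
Proof.
have [c uc] := bas_span u; rewrite {1}uc; apply: eq_bigr => i _; congr (sc _ *: _).
have il : (i <= l)%N by rewrite -ltnS.
rewrite uc scaler_sumr (bigD1 i) //= sc_scaleC mfrom_bas // big1 => [|j ji].
  by rewrite addr0 xiZ xi_bas mulr1.
have jl : (j <= l)%N by rewrite -ltnS.
rewrite sc_scaleC -mfrom_r -scalerA bas_vertex_neq ?scaler0 //.
by apply/eqP; rewrite vert_inj // eq_sym.
Qed.

Lemma vertex_out v (u : U) : v \notin pverts p -> e v *: u = 0.
Proof.
move=> vp; rewrite [u]bas_decomp scaler_sumr big1 // => i _.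
have il : (i <= l)%N by rewrite -ltnS.
rewrite sc_scaleC bas_vertex_neq ?scaler0 // => vi.
by move: vp; rewrite vi vert_mem.
Qed.

Lemma vertex_comp i (u : U) : (i <= l)%N -> e (vt i) *: u = sc (xi (F i *: u)) *: bas i.
Proof.
move=> il; rewrite {1}[u]bas_decomp scaler_sumr (bigD1 (Ordinal (n:=l.+1) il)) //=.
rewrite sc_scaleC bas_vertex // big1 ?addr0 // => j ji.
have jl : (j <= l)%N by rewrite -ltnS.
rewrite sc_scaleC bas_vertex_neq ?scaler0 //.
by apply/eqP; rewrite vert_inj // eq_sym.
Qed.

Lemma top_vertex : e (vt 0) *: top = top.
Proof. by rewrite -bas0 bas_vertex. Qed.

Lemma top_generates (u : U) : exists a, u = a *: top.
Proof.
exists (\sum_(i < l.+1) sc (xi (F i *: u)) * T i).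
rewrite scaler_suml {1}[u]bas_decomp; apply: eq_bigr => i _.
by rewrite /bas scalerA.
Qed.

Lemma reach_scale0 i j a (u : U) : (i <= j <= l)%N -> J a -> e (vt i) *: (a *: (e (vt j) *: u)) = 0.
Proof.
move=> ij Ja; have [q [qs _ qe]] := subpath_between ij.
by rewrite !scalerA -qs -qe (reach_jacobson0 admI acyG) ?scale0r.
Qed.

(** No nontrivial path leads from a vertex of the mast back to its start. *)
Lemma vertex0_radical a (u : U) : J a -> e (vt 0) *: (a *: u) = 0.
Proof.
move=> Ja; rewrite [u]bas_decomp !scaler_sumr big1 // => i _.
have il : (i <= l)%N by rewrite -ltnS.
by rewrite -(bas_vertex il) !sc_scaleC reach_scale0 ?scaler0.
Qed.

Lemma radical_bas a : J a -> a *: bas l = 0.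
Proof.
move=> Ja; rewrite [LHS]bas_decomp big1 // => i _.
have il : (i <= l)%N by rewrite -ltnS.
rewrite -mfrom_r -scalerA -(bas_vertex (leqnn l)) reach_scale0 ?il ?leqnn //.
by rewrite scaler0 xi0 sc0 scale0r.
Qed.

Lemma path_xi_radical u : u \in @rad_pred _ U -> P *: u = 0.
Proof.
case/rad_predP=> n [a [y [Ja _ ->]]]; rewrite scaler_sumr big1 // => i _.
by rewrite -path_r -scalerA vertex0_radical ?scaler0.
Qed.

(** JU is spanned by the basis vectors other than the top; P u is the top
    coordinate of u times bas l. *)
Lemma radicalE u : (u \in @rad_pred _ U) = (xi (P *: u) == 0).
Proof.
apply/idP/eqP => [/path_xi_radical ->|]; first exact: xi0.
rewrite -mfrom0 => u0; rewrite [u]bas_decomp big_ord_recl /= u0 sc0 scale0r add0r.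
apply: rpred_sum => i _; apply: rpredZ; rewrite /bump add1n.
have [a _ Ta] := mast_arrow_nth I (ltn_ord i); rewrite /bas Ta -scalerA.
apply/rad_predP; exists 1%N, (fun=> arrow_class I a), (fun=> T i *: top).
split=> // [_|]; last by rewrite big_ord1.
by apply/(jacobsonE admI acyG); exact: deg_arrow.
Qed.

Lemma xi_path_scale a u : xi (P *: (a *: u)) = vcoef (vt 0) a * xi (P *: u).
Proof.
rewrite -xiZ -sc_scaleC -path_r -!scalerA sc_scaleC; congr (xi (_ *: _)).
have := vcoef_decomp admI a => /(jacobsonE admI acyG) /(@vertex0_radical _ u).
rewrite scalerBl scalerBr => /eqP; rewrite subr_eq0 => /eqP ->.
rewrite scaler_suml scaler_sumr (bigD1 (vt 0)) //= big1 => [|w w0].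
  by rewrite addr0 scE -scalerA sc_scaleC [e _ *: (_ *: _)]scalerA vertex_idem.
by rewrite scE -scalerA sc_scaleC [e _ *: (_ *: _)]scalerA vertexM eq_sym (negbTE w0) scale0r scaler0.
Qed.

(** If l = 0, then U is one-dimensional. *)
Lemma simple_module_length0 : l = 0%N -> simple_module U.
Proof.
move=> l0; split; first by exists (bas l); exact: basl_neq0.
move=> S [S0 SP].
have lin u : u = sc (xi (F 0 *: u)) *: bas l.
  by rewrite {1}[u]bas_decomp l0 big_ord1.
have [h|/existsNP[y /not_implyP[Sy y0]]] := pselect (forall y, S y -> y = 0).
  by left; apply/seteqP; split=> [y /h //|y ->].
right; apply/seteqP; split=> // u _; rewrite [u]lin -[_ *: _]addr0.
have c0 : xi (F 0 *: y) != 0.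
  by apply: contra_notN y0 => /eqP c0; rewrite [y]lin c0 sc0 scale0r.
have -> : bas l = sc (xi (F 0 *: y))^-1 *: y by rewrite {2}[y]lin scalerA scV ?scale1r.
by rewrite scalerA; apply: SP.
Qed.

End UniserialModule.

(** * From the conditions to irreducibility *)

Lemma alg_arrow_ind (K : fieldType) (G : quiver) (I : ideal (pathalg K G))
    (S : set (quotalg I)) : subspace S ->
  (forall v, S (path_class I (vpath v))) ->
  (forall g x, S x -> S (arrow_class I g * x)) -> forall a, S a.
Proof.
move=> sS Sv Sg; apply: alg_span => // q.
move: {2}(parrows q) (erefl (parrows q)) => s; elim/last_ind: s q => [|s g IH] q qs.
  have -> : q = vpath (pstart q) by apply: qpath_inj.
  exact: Sv.
by have [q' [q's _ _ ->]] := path_class_rcons I qs; apply/Sg/IH.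
Qed.

Section Sufficiency.
Variables (K : fieldType) (G : quiver) (I : ideal (pathalg K G)).
Hypotheses (admI : admissible I) (acyG : acyclic_quiver G).
Variables (p : qpath G) (U : lmodType (quotalg I)).
Local Notation A := (quotalg I).
Local Notation e v := (path_class I (vpath v)).
Local Notation P := (path_class I p).
Local Notation l := (plength p).
Local Notation vt := (vert p).
Local Notation F := (mfrom I p).
Local Notation T := (mto I p).
Local Notation J := (jacobson A).
Local Notation sc := (@sc K G I).
Variable x0 : U.
Hypotheses (Px0 : P *: x0 <> 0) (lenU : module_length U l.+1).
Local Notation top := (top p x0).
Local Notation bas := (bas p x0).
Local Notation xi := (xi p x0).

Lemma mfrom_bas_sum (c : 'I_l.+1 -> K) (j : 'I_l.+1) :
  F j *: (\sum_i sc (c i) *: bas i) = sc (c j) *: bas l.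
Proof.
have jl : (j <= l)%N by rewrite -ltnS.
rewrite scaler_sumr (bigD1 j) //= sc_scaleC mfrom_bas // big1 ?addr0 // => i ij.
have il : (i <= l)%N by rewrite -ltnS.
rewrite sc_scaleC -mfrom_r -scalerA bas_vertex_neq ?scaler0 //.
by apply/eqP; rewrite vert_inj // eq_sym.
Qed.

(** U is generated by its top, so a map is given by a vector that satisfies the
    relations of the top. *)
Lemma linear_of_top (X : lmodType A) (v : X) :
  (forall a, a *: top = 0 -> a *: v = 0) -> exists s : {linear U -> X}, s top = v.
Proof.
move=> ann; have gen u : exists a, u = a *: top := top_generates admI acyG Px0 lenU u.
pose f u := xget 0 [set a | u = a *: top].
have fE u : u = f u *: top.
  by have [a ua] := gen u; apply: (@xgetPex _ (0 : A) [set a | u = a *: top]); exists a.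
have annE a b : a *: top = b *: top -> a *: v = b *: v.
  move=> ab; apply/eqP; rewrite -subr_eq0 -scalerBl; apply/eqP/ann.
  by rewrite scalerBl ab subrr.
have sl : linear (fun u => f u *: v).
  move=> c u t; rewrite scalerA -scalerDl; apply: annE.
  by rewrite scalerDl -scalerA -!fE.
pose s : {linear U -> X} := HB.pack (fun u => f u *: v) (GRing.isLinear.Build _ _ _ _ _ sl).
by exists s; rewrite -[v in RHS]scale1r; apply: annE; rewrite -fE scale1r.
Qed.

Lemma top_not_radical : top \notin @rad_pred _ U.
Proof.
rewrite (radicalE admI acyG Px0 lenU) -mfrom0 -bas0 mfrom_bas //.
by rewrite (xi_bas admI acyG Px0 lenU) oner_eq0.
Qed.

(** A section would put the top into JU; a retraction would send the top to a
    vector of e_(v_0) JU = 0, hence kill bas 1. *)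
Lemma radical_embedding_not_split : (0 < l)%N ->
  ~ split_mono (radical_embedding U) /\ ~ split_epi (radical_embedding U).
Proof.
move=> l0; split=> [[g gK]|[g gK]]; last first.
  have := valP (g top); rewrite -[val (g top)]/(radical_embedding U (g top)) gK.
  by rewrite (negbTE top_not_radical).
have [a _ Ta] := mast_arrow_nth I l0.
have b1 : bas 1 \in @rad_pred _ U.
  rewrite (radicalE admI acyG Px0 lenU) -mfrom0 -mfrom_r -scalerA.
  rewrite bas_vertex_neq ?scaler0 ?(xi0 admI acyG Px0 lenU) //.
  by apply/eqP; rewrite vert_inj.
have b1E : bas 1 = arrow_class I a *: top by rewrite /bas Ta -scalerA -/(bas 0) bas0.
have gt0 : val (g top) = 0.
  rewrite -(top_vertex p x0) linearZ /=.
  rewrite (vertex_comp admI acyG Px0 lenU _ (leq0n l)) mfrom0.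
  rewrite (path_xi_radical admI acyG Px0 lenU (valP (g top))).
  by rewrite (xi0 admI acyG Px0 lenU) sc0 scale0r.
have : bas 1 = 0.
  have := gK (Sub (bas 1) b1) => /(congr1 val) /= <-.
  by rewrite b1E linearZ /= gt0 scaler0.
move=> /(congr1 (fun u => F 1 *: u)); rewrite mfrom_bas // scaler0.
exact: basl_neq0.
Qed.

Section Conditions.
(** The first group of conditions, stated as a description of A e_(v_0). *)
Hypothesis corner : forall a, exists (c : 'I_l.+1 -> K) b,
  J b /\ a * e (vt 0) = \sum_i sc (c i) * T i + b * P.
Hypothesis length_gt0 : (0 < l)%N.
Variable R : seq A.
Hypothesis RJ : forall r, r \in R -> J r.
(** What the basis property of R is used for: the r P generate J P. *)
Hypothesis Rgen : forall (X : lmodType A) (v : X), (forall r, r \in R -> r *: (P *: v) = 0) ->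
  forall b, J b -> b *: (P *: v) = 0.
Hypothesis RC : forall g j, (0 < j <= l)%N -> src g \notin pverts p -> tgt g = vt j ->
  exists2 w, J w & forall r, r \in R -> r * F j * arrow_class I g = r * (P * w).
(** The same scalar k occurs on both sides, for all r. *)
Hypothesis RD : forall d i j, (i <= l)%N -> (j <= l)%N -> d \notin parrows p ->
  src d = vt i -> tgt d = vt j -> exists2 k, arrow_class I d * T i = sc k * T j &
    forall r, r \in R -> r * F j * arrow_class I d = sc k * (r * F i).

(** By [corner] the relations of the top are generated by J P. *)
Lemma linear_of_path_killed (X : lmodType A) (v : X) : e (vt 0) *: v = v ->
  (forall r, r \in R -> r *: (P *: v) = 0) -> exists s : {linear U -> X}, s top = v.
Proof.
move=> v0 Rv; apply: linear_of_top => a.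
have [c [b [Jb ac]]] := corner a.
rewrite -(top_vertex p x0) -v0 [a *: (_ *: top)]scalerA [a *: (_ *: v)]scalerA ac.
rewrite !scalerDl -!scalerA.
have -> : P *: top = bas l by rewrite -mfrom0 -bas0 mfrom_bas.
rewrite (radical_bas admI acyG Px0 lenU Jb) (Rgen Rv Jb) !addr0 !scaler_suml.
under eq_bigr do rewrite -scalerA -/(bas _).
move=> h; rewrite big1 // => i _.
have := mfrom_bas_sum c i; rewrite h scaler0 => /esym/sc_eq0 ->; last exact: basl_neq0.
by rewrite sc0 mul0r scale0r.
Qed.

Section Factorization.
Variables (X : lmodType A) (h : {linear radical_module U -> X}) (g : {linear X -> U}).
Hypothesis fac : radical_embedding U =1 g \o h.
Hypothesis nsplit : ~ split_epi g.

Let m := size R.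
Let W := {ffun 'I_m -> restr X}.
Let zz i (v : X) : W := [ffun k : 'I_m => R`_k *: (F i *: v) : restr X].

Let zzP i c (v w : X) : zz i (sc c *: v + w) = c *: zz i v + zz i w.
Proof.
by apply/ffunP => k; rewrite !ffunE !scalerDr !sc_scaleC.
Qed.

Let zz0 i : zz i 0 = 0.
Proof. by apply/ffunP => k; rewrite !ffunE !scaler0. Qed.

(** If the vectors r P v all vanish while xi (P g v) = c is not zero, then the
    map sending top to c^-1 e_(v_0) v is a section of g. *)
Lemma coordinate_functional : exists2 L : {scalar W}, True &
  forall v, L (zz 0 v) = xi (P *: g v).
Proof.
have [|L _ LE] := @functional_extension K W
   [set y | exists v, y = (zz 0 v, xi (P *: g v))]; last first.
  by exists L => // v; apply: LE; exists v.
split.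
- by exists 0; rewrite zz0 linear0 scaler0 (xi0 admI acyG Px0 lenU).
- move=> c x a y b [v [-> ->]] [w [-> ->]]; exists (sc c *: v + w).
  by rewrite zzP linearP /= scalerDr sc_scaleC (xiP admI acyG Px0 lenU).
move=> a [v [z0 ->]]; apply/eqP; apply: contra_notT nsplit => a0.
have Rv r : r \in R -> r *: (P *: (e (vt 0) *: v)) = 0.
  move=> rR; have rm : (index r R < m)%N by rewrite index_mem.
  have /ffunP/(_ (Ordinal rm)) := z0; rewrite !ffunE /= nth_index // mfrom0.
  by rewrite [P *: (_ *: _)]scalerA path_r => <-.
have v0 : e (vt 0) *: (e (vt 0) *: v) = e (vt 0) *: v by rewrite scalerA vertex_idem.
have [s st] := linear_of_path_killed v0 Rv.
set c := xi (P *: g v) in a0.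
have gs u : g (s u) = sc c *: u.
  have [b ->] := top_generates admI acyG Px0 lenU u.
  rewrite linearZ /= st !linearZ /= (vertex_comp admI acyG Px0 lenU _ (leq0n l)).
  by rewrite mfrom0 -/c bas0 // sc_scaleC.
have tl : linear (fun u => sc c^-1 *: s u).
  by move=> b u t; rewrite linearP scalerDr sc_scaleC.
pose t : {linear U -> X} := HB.pack (fun u => sc c^-1 *: s u) (GRing.isLinear.Build _ _ _ _ _ tl).
exists t => u; rewrite /= linearZ /= gs scalerA scV ?scale1r //.
Qed.

(** The map phi v, the sum of the L((r F_i v)_r) bas i, is A-linear: idempotents
    are clear, and for an arrow from v_i to v_j the two sides are compared
    according to whether the arrow enters the mast (RC, or radical values at
    v_0), leaves it (both sides vanish), belongs to it, or joins two of its
    vertices (RD). *)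
Lemma factor_split_mono : split_mono h.
Proof.
have [L _ LE] := coordinate_functional.
pose lam i v := L (zz i v).
have lamP i c v w : lam i (sc c *: v + w) = c * lam i v + lam i w.
  by rewrite /lam zzP linearP.
have lam0 i : lam i 0 = 0 by rewrite /lam zz0 linear0.
have lamE i v : lam i (e (vt i) *: v) = lam i v.
  by congr (L _); apply/ffunP => k; rewrite !ffunE [F i *: _]scalerA mfrom_r.
have lam_neq i w v : w <> vt i -> lam i (e w *: v) = 0.
  move=> wi; rewrite -lamE scalerA vertexM; case: eqP => [/esym/wi //|_].
  by rewrite scale0r lam0.
have lam_rad w v : J w -> lam 0 (w *: v) = 0.
  move=> Jw; rewrite /lam LE linearZ /= -path_r -scalerA.
  rewrite (vertex0_radical admI acyG Px0 lenU) // scaler0.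
  exact: xi0.
pose phi v := \sum_(i < l.+1) sc (lam i v) *: bas i.
have phiP c v w : phi (sc c *: v + w) = sc c *: phi v + phi w.
  rewrite /phi scaler_sumr -big_split /=; apply: eq_bigr => i _.
  by rewrite lamP scD scM scalerDl scalerA.
have phi_only i v : (i <= l)%N -> (forall j, (j <= l)%N -> j != i -> lam j v = 0) ->
    phi v = sc (lam i v) *: bas i.
  move=> il hj; rewrite /phi (bigD1 (Ordinal (n:=l.+1) il)) //= big1 ?addr0 // => j ji.
  by rewrite hj ?sc0 ?scale0r // -ltnS.
have phi_none v : (forall j, (j <= l)%N -> lam j v = 0) -> phi v = 0.
  by move=> hj; rewrite /phi big1 // => j _; rewrite hj ?sc0 ?scale0r // -ltnS.
have phiV i v : (i <= l)%N -> e (vt i) *: phi v = sc (lam i v) *: bas i.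
  move=> il; rewrite /phi scaler_sumr (bigD1 (Ordinal (n:=l.+1) il)) //=.
  rewrite sc_scaleC bas_vertex // big1 ?addr0 // => j ji.
  have jl : (j <= l)%N by rewrite -ltnS.
  rewrite sc_scaleC bas_vertex_neq ?scaler0 //.
  by apply/eqP; rewrite vert_inj // eq_sym.
have out := vertex_out admI acyG Px0 lenU.
have phi_vertex w v : phi (e w *: v) = e w *: phi v.
  have [/vertP[i il ->]|wp] := boolP (w \in pverts p).
    rewrite phiV // (phi_only i) ?lamE // => j jl ji.
    by apply: lam_neq; apply/eqP; rewrite vert_inj // eq_sym.
  rewrite out // phi_none // => j jl; apply: lam_neq => wj.
  by move: wp; rewrite wj vert_mem.
have phi_arrow a v : phi (arrow_class I a *: v) = arrow_class I a *: phi v.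
  have arr_src (Y : lmodType A) (y : Y) :
      arrow_class I a *: y = arrow_class I a *: (e (src a) *: y).
    by rewrite scalerA arrow_vertex eqxx.
  have arr_tgt (Y : lmodType A) (y : Y) :
      arrow_class I a *: y = e (tgt a) *: (arrow_class I a *: y).
    by rewrite scalerA vertex_arrow eqxx.
  (* An arrow that leaves the mast: both sides lie in e (tgt a) U = 0. *)
  have [/vertP[j jl aj]|ap] := boolP (tgt a \in pverts p); last first.
    by rewrite arr_tgt phi_vertex [RHS]arr_tgt !out.
  (* An arrow that enters the mast: the right-hand side lies in a e (src a) U = 0. *)
  have [/vertP[i il ai]|sp] := boolP (src a \in pverts p); last first.
    rewrite [RHS]arr_src out // scaler0 arr_tgt phi_vertex aj phiV //.
    suff -> : lam j (arrow_class I a *: v) = 0 by rewrite sc0 scale0r.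
    have [j0|j0] := posnP j.
      by rewrite j0 lam_rad //; apply/(jacobsonE admI acyG); exact: deg_arrow.
    have [|w Jw hw] := @RC a j _ sp aj; first by rewrite j0.
    have <- : lam 0 (w *: v) = lam j (arrow_class I a *: v); last exact: lam_rad.
    congr (L _); apply/ffunP => k; rewrite !ffunE mfrom0 !scalerA.
    by rewrite hw ?mulrA // mem_nth.
  rewrite arr_tgt phi_vertex aj phiV // [RHS]arr_src ai phiV // sc_scaleC.
  (* An arrow between two vertices of the mast, k = 1 if it belongs to the mast. *)
  suff [k ak lk] : exists2 k, arrow_class I a * T i = sc k * T j &
      lam j (arrow_class I a *: v) = k * lam i v.
    have -> : arrow_class I a *: bas i = sc k *: bas j.
      by rewrite /bas [arrow_class I a *: _]scalerA ak -scalerA.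
    by rewrite lk mulrC scM scalerA.
  have [ap|ap] := boolP (a \in parrows p).
    have [i' [i'l ai' aj' Ta Fa]] := mast_arrow I ap.
    have ei : i' = i.
      by apply/eqP; rewrite -(vert_inj (p := p) acyG) // ?(ltnW i'l) // -ai' ai.
    have ej : i'.+1 = j by apply/eqP; rewrite -(vert_inj (p := p) acyG) // -aj' aj.
    exists 1; rewrite ?sc1 ?mul1r -?ei -?ej //.
    by congr (L _); apply/ffunP => k; rewrite !ffunE [F _ *: (_ *: _)]scalerA -Fa.
  have [k ak hk] := RD il jl ap ai aj; exists k => //.
  have -> : k * lam i v = L (k *: zz i v) by rewrite linearZ.
  congr (L _); apply/ffunP => s; rewrite !ffunE restrE !scalerA.
  by rewrite -[R`_s * F j * _]/(R`_s * F j * _) hk ?mem_nth // mulrA.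
have phiD v w : phi (v + w) = phi v + phi w.
  by have := phiP 1 v w; rewrite !sc1 !scale1r.
have phi0 : phi 0 = 0 by apply: (addrI (phi 0)); rewrite -phiD !addr0.
have phiZ a : forall v, phi (a *: v) = a *: phi v.
  apply: (@alg_arrow_ind K G I [set a | forall v, phi (a *: v) = a *: phi v]).
  - split=> [v|c x y hx hy v] /=; first by rewrite !scale0r phi0.
    by rewrite scE !scalerDl -!scalerA phiP hx hy.
  - by move=> w v; exact: phi_vertex.
  - by move=> d x hx v; rewrite -!scalerA phi_arrow hx.
have rad v : g v - phi v \in @rad_pred _ U.
  rewrite (radicalE admI acyG Px0 lenU) scalerBr.
  rewrite (xiD admI acyG Px0 lenU) (xiN admI acyG Px0 lenU).
  have := mfrom_bas_sum (fun i => lam i v) ord0; rewrite -[\sum_i _]/(phi v) /= mfrom0.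
  move=> ->; rewrite (xiZ admI acyG Px0 lenU) (xi_bas admI acyG Px0 lenU) mulr1.
  by rewrite /lam LE subrr.
pose rho v : radical_module U := Sub (g v - phi v) (rad v).
have rl : linear rho.
  move=> a v w; apply: val_inj; rewrite /= linearP phiD phiZ scalerBr.
  by rewrite opprD addrACA.
pose r : {linear X -> radical_module U} := HB.pack rho (GRing.isLinear.Build _ _ _ _ _ rl).
exists r => y; apply: val_inj => /=.
have -> : phi (h y) = 0.
  apply: phi_none => j jl; rewrite /lam (_ : zz j (h y) = 0) ?linear0 //.
  apply/ffunP => k; rewrite !ffunE -!linearZ /= (_ : _ *: (_ *: _) = 0) ?linear0 //.
  apply: val_inj; rewrite /= (mfrom_xi admI acyG Px0 lenU) // sc_scaleC.
  rewrite (radical_bas admI acyG Px0 lenU) ?scaler0 //.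
  by apply: RJ; rewrite mem_nth.
by rewrite subr0 -[g (h y)]/((g \o h) y) -fac.
Qed.

End Factorization.

Lemma radical_embedding_irreducible : irreducible_map (radical_embedding U).
Proof.
have [nm ne] := radical_embedding_not_split length_gt0.
split=> // X h g _ fac; have [sg|sg] := pselect (split_epi g); first by right.
by left; exact: factor_split_mono fac sg.
Qed.

End Conditions.
End Sufficiency.

(** * Factoring through a quotient: the annihilator of the top *)

(** Bundled, so that the quotient carries canonical structures. *)
Record submod (A : pzRingType) (M : lmodType A) := Submod {
  submod_set :> set M;
  submodP : submodule submod_set }.

Section QuotientModule.
Variables (A : pzRingType) (M : lmodType A) (S : submod M).

Definition submod_pred (x : M) : bool := `[< submod_set S x >].

Lemma submod_pred_zmod : zmod_closed submod_pred.
Proof.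
have [S0 SP] := submodP S; split; first exact/asboolP.
move=> x y /asboolP Sx /asboolP Sy; apply/asboolP.
by rewrite addrC -scaleN1r; apply: SP.
Qed.
HB.instance Definition _ := GRing.isZmodClosed.Build M submod_pred submod_pred_zmod.

Definition submod_zmod := GRing.ZmodClosed.clone M submod_pred _.
Definition quotmod := Quotient.quot submod_zmod.
HB.instance Definition _ := GRing.Zmodule.on quotmod.

Definition qproj (x : M) : quotmod := \pi_(Quotient.quot submod_zmod) x.
Definition qlift (x : quotmod) : M := repr x.

Lemma qprojP x y : qproj x = qproj y <-> submod_set S (x - y).
Proof.
split=> [/eqP|h]; first by rewrite -Quotient.idealrBE => /asboolP.
by apply/eqP; rewrite -Quotient.idealrBE; apply/asboolP.
Qed.

Lemma qliftK : cancel qlift qproj.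
Proof. exact: reprK. Qed.

Lemma qprojD : {morph qproj : x y / x + y}.
Proof. exact: (raddfD \pi_(Quotient.quot submod_zmod)). Qed.

Definition quotmod_scale (a : A) (x : quotmod) : quotmod := qproj (a *: qlift x).

Lemma qproj_scale a x : quotmod_scale a (qproj x) = qproj (a *: x).
Proof.
apply/qprojP; rewrite -scalerBr -[_ *: _]addr0; have [S0 SP] := submodP S.
by apply: SP => //; apply/qprojP; rewrite qliftK.
Qed.

Lemma quotmod_scaleA a b x : quotmod_scale a (quotmod_scale b x) = quotmod_scale (a * b) x.
Proof. by rewrite -[x]qliftK !qproj_scale scalerA. Qed.
Lemma quotmod_scale1 : left_id 1 quotmod_scale.
Proof. by move=> x; rewrite -[x]qliftK qproj_scale scale1r. Qed.
Lemma quotmod_scaleDr : right_distributive quotmod_scale +%R.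
Proof.
by move=> a x y; rewrite -[x]qliftK -[y]qliftK -qprojD !qproj_scale scalerDr qprojD.
Qed.
Lemma quotmod_scaleDl x : {morph quotmod_scale^~ x : a b / a + b}.
Proof. by move=> a b; rewrite -[x]qliftK !qproj_scale scalerDl qprojD. Qed.
HB.instance Definition _ := GRing.Zmodule_isLmodule.Build A quotmod
  quotmod_scaleA quotmod_scale1 quotmod_scaleDr quotmod_scaleDl.

Lemma qproj_linear : linear qproj.
Proof. by move=> a x y; rewrite qprojD -qproj_scale. Qed.
HB.instance Definition _ := GRing.isLinear.Build A M quotmod _ qproj qproj_linear.

Lemma qproj_eq0 x : qproj x = 0 <-> submod_set S x.
Proof. by rewrite -(linear0 qproj) qprojP subr0. Qed.

Lemma quotmod_factor (N : lmodType A) (f : {linear M -> N}) :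
  (forall x, submod_set S x -> f x = 0) -> exists g : {linear quotmod -> N},
    forall x, g (qproj x) = f x.
Proof.
move=> fS; pose g x := f (qlift x).
have gE x : g (qproj x) = f x.
  apply/eqP; rewrite -subr_eq0 -linearB; apply/eqP/fS/qprojP.
  exact: qliftK.
have gl : linear g.
  by move=> a x y; rewrite -[x]qliftK -[y]qliftK -linearP !gE linearP.
by exists (HB.pack_for {linear quotmod -> N} g (GRing.isLinear.Build _ _ _ _ _ gl)).
Qed.

End QuotientModule.

Section Annihilator.
Variables (K : fieldType) (G : quiver) (I : ideal (pathalg K G)).
Hypotheses (admI : admissible I) (acyG : acyclic_quiver G).
Variables (p : qpath G) (U : lmodType (quotalg I)).
Local Notation A := (quotalg I).
Local Notation e v := (path_class I (vpath v)).
Local Notation P := (path_class I p).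
Local Notation l := (plength p).
Local Notation vt := (vert p).
Local Notation sc := (@sc K G I).
Variable x0 : U.
Hypotheses (Px0 : P *: x0 <> 0) (lenU : module_length U l.+1).
Local Notation top := (top p x0).
Local Notation bas := (bas p x0).
Local Notation xi := (xi p x0).
Local Notation JU := (radical_module U).
Hypothesis length_gt0 : (0 < l)%N.

Hypothesis irr : irreducible_map (radical_embedding U).

Lemma path_top : P *: top = bas l.
Proof. by rewrite -mfrom0 -bas0 mfrom_bas. Qed.

Lemma path_top_radical : P *: top \in @rad_pred _ U.
Proof.
rewrite (radicalE admI acyG Px0 lenU) path_top -mfrom0 -mfrom_r -scalerA.
rewrite bas_vertex_neq ?scaler0 ?(xi0 admI acyG Px0 lenU) //.
by apply/eqP; rewrite vert_inj // eq_sym -lt0n.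
Qed.

Lemma radical_submodule_fg : finitely_generated JU.
Proof.
exists l, (fun i : 'I_l => insubd (0 : JU) (bas i.+1)) => y.
exists (fun i : 'I_l => sc (xi (mfrom I p i.+1 *: val y))); apply: val_inj.
rewrite linear_sum /= {1}[val y](bas_decomp admI acyG Px0 lenU).
have := valP y; rewrite (radicalE admI acyG Px0 lenU) -mfrom0 => /eqP y0.
rewrite big_ord_recl /= y0 sc0 scale0r add0r; apply: eq_bigr => i _.
congr (_ *: _); rewrite -[RHS]/(val (insubd (0 : JU) (bas i.+1))) insubdK //.
rewrite -topredE /= (radicalE admI acyG Px0 lenU).
rewrite -mfrom0 -mfrom_r -scalerA.
rewrite bas_vertex_neq ?scaler0 ?(xi0 admI acyG Px0 lenU) //.
by apply/eqP; rewrite vert_inj.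
Qed.

(** The relations of the pushout of A P -> A along A P -> JU, b P |-> b P top. *)
Let graph : set (A^o * JU)%type :=
  [set z | exists b, z.1 = b * P /\ val z.2 = - (b *: (P *: top))].

Let graph_sub : submodule graph.
Proof.
split; first by exists 0; rewrite mul0r scale0r oppr0.
move=> a x y [b [x1 x2]] [c [y1 y2]]; exists (a * b + c); split=> /=.
  by rewrite -[LHS]/(a * x.1 + y.1 : A) x1 y1 mulrDl mulrA.
by rewrite x2 y2 scalerN -opprD [(a * b + c) *: _]scalerDl -[(a * b) *: _]scalerA.
Qed.

Let M := quotmod (Submod graph_sub).
Let pr : {linear (A^o * JU)%type -> M} := @qproj _ _ (Submod graph_sub).

Let M_fg : finitely_generated M.
Proof.
have [n [f fE]] := radical_submodule_fg.
exists n.+1, (fun i => oapp (fun j => pr (0, f j)) (pr (1, 0)) (unlift ord0 i)).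
move=> x; have [c yE] := fE (qlift x).2.
exists (fun i => oapp c (qlift x).1 (unlift ord0 i)).
rewrite big_ord_recl unlift_none /=; under eq_bigr do rewrite liftK /= -linearZ.
rewrite -linear_sum -linearZ -linearD -[LHS]qliftK; congr (pr _).
have -> : \sum_i c i *: ((0, f i) : (A^o * JU)%type) = (0, \sum_i c i *: f i).
  by elim/big_rec2: _ => // i y1 y2 _ ->; congr pair; rewrite /= scaler0 addr0.
rewrite -yE; case: (qlift x) => a y; congr pair; rewrite /=.
  by rewrite addr0 -[RHS]/(a * 1) mulr1.
by rewrite scaler0 add0r.
Qed.

(** If the map from JU to the quotient M had a retraction s, then y = s(1, 0) in
    JU would satisfy P y = P top <> 0, but P kills JU.  So M -> U has a section,
    which sends top to the class of some (a1, 0) with a1 = e_(v_0) a1 and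
    a1 e_(v_0) = e_(v_0); an element that kills top kills this class. *)
Lemma annihilator_top a : a *: top = 0 -> exists b, a * e (vt 0) = b * P.
Proof.
have vl0 : linear (fun z : (A^o * JU)%type => (z.1 : A) *: top + val z.2).
  move=> c x y; rewrite /= scalerDl scalerDr scalerA addrACA; congr (_ + _).
pose f : {linear (A^o * JU)%type -> U} := HB.pack
   (fun z : (A^o * JU)%type => (z.1 : A) *: top + val z.2)
   (GRing.isLinear.Build _ _ _ _ _ vl0).
have [z [b [z1 z2]]|g gE] := @quotmod_factor _ _ (Submod graph_sub) U f.
  by rewrite /f /= z1 z2 -scalerA subrr.
have hl : linear (fun y : JU => pr (0, y)).
  move=> c x y; rewrite -linearP; congr (pr _); congr pair => /=.
  by rewrite scaler0 addr0.
pose h : {linear JU -> M} := HB.pack (fun y : JU => pr (0, y))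
   (GRing.isLinear.Build _ _ _ _ _ hl).
have [_ _ /(_ M h g M_fg)] := irr.
case=> [y|[s sK]|[s sK]].
- by rewrite /= [g _]gE /f /= scale0r add0r.
- pose y := s (pr (1, 0)); pose w : JU := Sub (P *: top) path_top_radical.
  have : P *: val y = bas l.
    have Pw : P *: y = w.
      rewrite /y -linearZ -linearZ -[RHS]sK; congr (s _); apply/qprojP => /=.
      exists 1; rewrite mul1r scale1r; split=> /=.
        by rewrite -[LHS]/(P * 1 - 0) mulr1 subr0.
      by rewrite scaler0 sub0r.
    by rewrite -path_top -[RHS]/(val w) -Pw.
  by rewrite (path_xi_radical admI acyG Px0 lenU (valP y)) => /esym/basl_neq0.
move=> at0.
pose z := qlift (s top); pose a1 : A := e (vt 0) * z.1.
have st : s top = pr (a1, 0).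
  rewrite -(top_vertex p x0) linearZ /= -[s top]qliftK -/z -[qproj _ z]/(pr z).
  rewrite -linearZ; congr (pr _); rewrite [LHS]surjective_pairing; congr pair.
  apply: val_inj; rewrite /= (vertex_comp admI acyG Px0 lenU _ (leq0n l)) mfrom0.
  rewrite (path_xi_radical admI acyG Px0 lenU (valP z.2)).
  by rewrite (xi0 admI acyG Px0 lenU) sc0 scale0r.
have a1t : a1 *: top = top.
  by rewrite -[RHS]sK st [g _]gE /f /= addr0.
have a1e : a1 * e (vt 0) = sc (vcoef (vt 0) z.1) * e (vt 0).
  by rewrite /a1 vertex_corner // scE.
have /eqP : vcoef (vt 0) z.1 - 1 = 0.
  apply: (@sc_eq0 _ _ _ _ _ top); last first.
    by move=> t0; have /negP := top_not_radical admI acyG Px0 lenU; rewrite t0 rpred0.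
  rewrite scD scN sc1 scalerBl scale1r -{2}a1t -(top_vertex p x0).
  by rewrite [a1 *: (_ *: _)]scalerA a1e -scalerA subrr.
rewrite subr_eq0 => /eqP v1; rewrite v1 sc1 mul1r in a1e.
have : a *: s top = 0 by rewrite -linearZ at0 linear0.
rewrite st -linearZ => /qproj_eq0[b [/= ab _]]; exists b.
by rewrite -a1e mulrA [a * a1]ab -mulrA path_r.
Qed.

End Annihilator.

(** * Factoring through functionals: the dual tuple *)

Section RightTuples.
Variables (K : fieldType) (G : quiver) (I : ideal (pathalg K G)) (m : nat).
Local Notation A := (quotalg I).
Local Notation Q := {ffun 'I_m -> A}.

(** Tuples form a right A-module Q. *)
Definition rmul (q : Q) (a : A) : Q := [ffun i => q i * a].

Lemma rmulA q a b : rmul (rmul q a) b = rmul q (a * b).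
Proof. by apply/ffunP => i; rewrite !ffunE mulrA. Qed.

Lemma rmul1 q : rmul q 1 = q.
Proof. by apply/ffunP => i; rewrite !ffunE mulr1. Qed.

Lemma rmulPl c q q' a : rmul (c *: q + q') a = c *: rmul q a + rmul q' a.
Proof. by apply/ffunP => i; rewrite !ffunE mulrDl -qscaleAl. Qed.

Lemma rmulPr q c a b : rmul q (c *: a + b) = c *: rmul q a + rmul q b.
Proof. by apply/ffunP => i; rewrite !ffunE mulrDr -qscaleAr. Qed.

Lemma rmulDr q a b : rmul q (a + b) = rmul q a + rmul q b.
Proof. by apply/ffunP => i; rewrite !ffunE mulrDr. Qed.

Lemma tuples_finite : acyclic_quiver G ->
  exists s : seq Q, forall S : set Q, subspace S -> (forall x, x \in s -> S x) -> forall q, S q.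
Proof.
move=> acyG; have [t ht] := alg_finite I acyG.
pose inj (i : 'I_m) (a : A) : Q := [ffun j => if j == i then a else 0].
exists [seq inj i a | i <- enum 'I_m, a <- t] => S sS St q.
have -> : q = \sum_i inj i (q i).
  apply/ffunP => j; rewrite sum_ffunE (bigD1 j) //= ffunE eqxx big1 ?addr0 // => i.
  by rewrite ffunE eq_sym => /negbTE ->.
apply: subspace_sum => // i _; move: (q i) => a.
apply: (ht [set a | S (inj i a)]) => [|b bt].
  split=> [|c x y /= hx hy].
    rewrite /= (_ : inj i 0 = 0); first by case: sS.
    by apply/ffunP => j; rewrite !ffunE if_same.
  have -> : inj i (c *: x + y) = c *: inj i x + inj i y.
    by apply/ffunP => j; rewrite !ffunE; case: eqP; rewrite ?scaler0 ?addr0.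
  by case: sS => _; apply.
by apply: St; apply/allpairsP; exists (i, b); rewrite mem_enum.
Qed.

End RightTuples.

Section Necessity.
Variables (K : fieldType) (G : quiver) (I : ideal (pathalg K G)).
Hypotheses (admI : admissible I) (acyG : acyclic_quiver G).
Variables (p : qpath G) (U : lmodType (quotalg I)).
Local Notation A := (quotalg I).
Local Notation e v := (path_class I (vpath v)).
Local Notation P := (path_class I p).
Local Notation l := (plength p).
Local Notation vt := (vert p).
Local Notation F := (mfrom I p).
Local Notation T := (mto I p).
Local Notation J := (jacobson A).
Local Notation sc := (@sc K G I).
Variable x0 : U.
Hypotheses (Px0 : P *: x0 <> 0) (lenU : module_length U l.+1).
Local Notation top := (top p x0).
Local Notation bas := (bas p x0).
Local Notation xi := (xi p x0).
Local Notation JU := (radical_module U).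
Variables (m : nat) (z : {ffun 'I_m -> A}).
Local Notation Q := {ffun 'I_m -> A}.

Definition klinear (f : Q -> K) : Prop :=
  forall c q q', f (c *: q + q') = c * f q + f q'.

(** The K-dual of Q / z P J. *)
Definition kfunctional (f : Q -> K) : Prop :=
  [/\ klinear f & forall w, J w -> f (rmul z (P * w)) = 0].

(** The fibre product, over the simple top of U, of the dual of Q / z P J and U.
    Functionals are plain functions here; linearity is part of the predicate. *)
Definition fiber_pred (x : (Q -> K) * U) : bool :=
  `[< kfunctional x.1 /\ x.1 (rmul z P) = xi (P *: x.2) >].

Lemma klinear0 f : klinear f -> f 0 = 0.
Proof. by move=> fl; apply: (addrI (f 0)); have := fl 1 0 0; rewrite scale1r mul1r !addr0. Qed.

Lemma klinearD f q q' : klinear f -> f (q + q') = f q + f q'.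
Proof. by move=> fl; have := fl 1 q q'; rewrite scale1r mul1r. Qed.

Lemma klinearZ f c q : klinear f -> f (c *: q) = c * f q.
Proof. by move=> fl; have := fl c q 0; rewrite klinear0 // !addr0. Qed.

Lemma klinearB f q q' : klinear f -> f (q - q') = f q - f q'.
Proof. by move=> fl; rewrite addrC -scaleN1r fl mulN1r addrC. Qed.

Lemma klinear_sum f (T : Type) (r : seq T) (E : T -> Q) : klinear f ->
  f (\sum_(i <- r) E i) = \sum_(i <- r) f (E i).
Proof. by move=> fl; apply: big_morph; [move=> ? ?; exact: klinearD|exact: klinear0]. Qed.

Definition precomp (a : A) (f : Q -> K) : Q -> K := fun q => f (rmul q a).

Lemma kfunctional_act a f : kfunctional f -> kfunctional (precomp a f).
Proof.
move=> [fl fJ]; split=> [c q q'|w Jw]; first by rewrite /precomp rmulPl fl.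
by rewrite /precomp rmulA -mulrA fJ //; exact: jacobsonMr.
Qed.

(** Modulo J, right multiplication of P by a is the scalar vcoef (vt 0) a; hence
    f |-> f (z P) is A-linear to the simple module at v_0. *)
Lemma kfunctional_path a f : kfunctional f ->
  f (rmul z (P * a)) = vcoef (vt 0) a * f (rmul z P).
Proof.
move=> [fl fJ]; have := vcoef_decomp admI a; set b := _ - _ => /(jacobsonE admI acyG) Jb.
have aE : a = \sum_v vcoef v a *: e v + b by rewrite /b addrC subrK.
have Pa : P * a = vcoef (vt 0) a *: P + P * b.
  rewrite {1}aE mulrDr mulr_sumr (bigD1 (vt 0)) //= big1 => [|v v0]; last first.
    by rewrite -qscaleAr -path_r -mulrA vertexM eq_sym (negbTE v0) mulr0 scaler0.
  by rewrite addr0 -qscaleAr path_r.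
by rewrite Pa rmulPr klinearD // fJ // addr0 klinearZ.
Qed.

Lemma fiber_pred_zmod : zmod_closed fiber_pred.
Proof.
split.
  apply/asboolP; split=> /=; last by rewrite scaler0 (xi0 admI acyG Px0 lenU).
  by split=> // c q q'; rewrite [RHS]addr0 mulr0.
move=> [f u] [g t] /asboolP[/= [fl fJ] fu] /asboolP[/= [gl gJ] gt].
have fgE q : (f - g) q = f q - g q by [].
apply/asboolP; split=> /=; last first.
  by rewrite fgE scalerBr (xiD admI acyG Px0 lenU) (xiN admI acyG Px0 lenU) fu gt.
split=> [c q q'|w Jw]; last by rewrite fgE fJ ?gJ ?subrr.
by rewrite !fgE fl gl mulrBr opprD addrACA.
Qed.
HB.instance Definition _ := GRing.isZmodClosed.Build ((Q -> K) * U)%type fiber_pred fiber_pred_zmod.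

Definition fiber := {x : (Q -> K) * U | x \in fiber_pred}.
HB.instance Definition _ := SubChoice.on fiber.
HB.instance Definition _ := [SubChoice_isSubZmodule of fiber by <:].

Lemma fiber_act_subproof (a : A) (x : fiber) :
  (precomp a (val x).1, a *: (val x).2) \in fiber_pred.
Proof.
have /asboolP[kf fu] := valP x; apply/asboolP; split=> /=.
  exact: kfunctional_act.
by rewrite (xi_path_scale admI acyG Px0 lenU) /precomp rmulA kfunctional_path // fu.
Qed.
Definition fiber_act (a : A) (x : fiber) : fiber :=
  exist (fun y => y \in fiber_pred) (precomp a (val x).1, a *: (val x).2) (fiber_act_subproof a x).

Lemma fiber_klinear (x : fiber) : klinear (val x).1.
Proof. by have /asboolP[[]] := valP x. Qed.

Lemma fiber_actA a b x : fiber_act a (fiber_act b x) = fiber_act (a * b) x.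
Proof.
apply: val_inj; rewrite /= scalerA; congr pair; apply/funext => q.
by rewrite /precomp /= rmulA.
Qed.
Lemma fiber_act1 : left_id 1 fiber_act.
Proof.
move=> x; apply: val_inj; rewrite /= scale1r [RHS]surjective_pairing; congr pair.
by apply/funext => q; rewrite /precomp rmul1.
Qed.
Lemma fiber_actDr : right_distributive fiber_act +%R.
Proof. by move=> a x y; apply: val_inj; rewrite /= scalerDr. Qed.
Lemma fiber_actDl x : {morph fiber_act^~ x : a b / a + b}.
Proof.
move=> a b; apply: val_inj; rewrite /= scalerDl; congr pair; apply/funext => q.
by rewrite /precomp rmulDr klinearD //; exact: fiber_klinear.
Qed.
Definition fiber_mod : lmodType A := HB.pack_for (lmodType A) fiber
  (GRing.Zmodule_isLmodule.Build A fiber fiber_actA fiber_act1 fiber_actDr fiber_actDl).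


Lemma precomp_scalar c (x : fiber) q : (val (fiber_act (sc c) x)).1 q = c * (val x).1 q.
Proof.
rewrite /= /precomp -(klinearZ _ _ (fiber_klinear x)); congr ((val x).1 _).
by apply/ffunP => i; rewrite !ffunE scC scE.
Qed.

Let eval_linear (q : Q) : scalar (fun x : restr fiber_mod => (val (x : fiber)).1 q : K^o).
Proof.
move=> c x y; rewrite -[LHS]/((val (fiber_act (sc c) x)).1 q + (val (y : fiber)).1 q).
by rewrite precomp_scalar.
Qed.

Let coord_linear i : scalar (fun x : restr fiber_mod => xi (F i *: (val (x : fiber)).2) : K^o).
Proof.
move=> c x y.
rewrite -[LHS]/(xi (F i *: (sc c *: (val (x : fiber)).2 + (val (y : fiber)).2))).
by rewrite scalerDr sc_scaleC (xiP admI acyG Px0 lenU).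
Qed.

(** Finitely many evaluations and coordinates separate the points, so the fibre
    product is finite-dimensional. *)
Lemma fiber_fg : finitely_generated fiber_mod.
Proof.
have [s hs] := tuples_finite I m acyG.
pose ev q : {scalar (restr fiber_mod)} := HB.pack
  (fun x : restr fiber_mod => (val (x : fiber)).1 q : K^o)
  (GRing.isLinear.Build _ _ _ _ _ (eval_linear q)).
pose co i : {scalar (restr fiber_mod)} := HB.pack
  (fun x : restr fiber_mod => xi (F i *: (val (x : fiber)).2) : K^o)
  (GRing.isLinear.Build _ _ _ _ _ (coord_linear i)).
pose f (i : 'I_(size s + l.+1)) : {scalar (restr fiber_mod)} :=
  match fintype.split i with inl j => ev (s`_j) | inr j => co j end.
have [|x _ fx|t _ span] := @finite_span K (restr fiber_mod) _ f setT.
- by split.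
- have ev0 (j : 'I_(size s)) : (val (x : fiber)).1 (s`_j) = 0.
    by have := fx (unsplit (inl j)); rewrite /f unsplitK.
  have co0 (j : 'I_l.+1) : xi (F j *: (val (x : fiber)).2) = 0.
    by have := fx (unsplit (inr j)); rewrite /f unsplitK.
  apply: val_inj; rewrite [LHS]surjective_pairing; congr pair.
    apply/funext => q; apply: (hs [set q | (val (x : fiber)).1 q = 0]) => [|y ys].
      have xl := fiber_klinear x.
      split=> [|c y y' /= hy hy']; first exact: klinear0.
      by rewrite xl hy hy' mulr0 addr0.
    have ym : (index y s < size s)%N by rewrite index_mem.
    by have := ev0 (Ordinal ym); rewrite /= nth_index.
  rewrite [LHS](bas_decomp admI acyG Px0 lenU) big1 // => i _.
  by rewrite co0 sc0 scale0r.
exists (size t), (fun i => t`_i) => x; have [//|c xc] := span x.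
by exists (fun i => sc (c i)).
Qed.

Hypothesis zJ : forall i, J (z i).
Hypothesis irr : irreducible_map (radical_embedding U).

Let incl_subproof (y : JU) : ((fun=> 0) : Q -> K, val y) \in fiber_pred.
Proof.
apply/asboolP; split=> /=; last first.
  by rewrite (path_xi_radical admI acyG Px0 lenU (valP y)) (xi0 admI acyG Px0 lenU).
by split=> // c q q'; rewrite mulr0 addr0.
Qed.

Let incl (y : JU) : fiber :=
  exist (fun y => y \in fiber_pred) ((fun=> 0) : Q -> K, val y) (incl_subproof y).

Let incl_linear : linear (incl : JU -> fiber_mod).
Proof.
move=> c x y; apply: val_inj; congr pair; apply/funext => q.
by rewrite -[RHS]/(0 + 0 : K) addr0.
Qed.

Let second_linear : linear (fun x : fiber_mod => (val (x : fiber)).2).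
Proof. by []. Qed.

(** A section s of the projection to U is impossible: writing s top = (f, top),
    f (z P) is the top coordinate 1, but it is also the sum of the values of
    z_i P f at the unit tuples, and z_i P s(top) = s(z_i (P top)) = 0. *)
Lemma fiber_retraction : exists r : {linear fiber_mod -> U},
  (forall x : fiber, r x \in @rad_pred _ U) /\ forall y : JU, r (incl y) = val y.
Proof.
pose h : {linear JU -> fiber_mod} := HB.pack (incl : JU -> fiber_mod)
   (GRing.isLinear.Build _ _ _ _ _ incl_linear).
pose g : {linear fiber_mod -> U} := HB.pack (fun x : fiber_mod => (val (x : fiber)).2)
   (GRing.isLinear.Build _ _ _ _ _ second_linear).
have [_ _ /(_ fiber_mod h g fiber_fg)] := irr.
case=> [y //|[s sK]|[s sK]].
  have rl : linear (fun x : fiber_mod => val (s x)) by move=> c x y; rewrite !linearP.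
  pose r : {linear fiber_mod -> U} := HB.pack (fun x : fiber_mod => val (s x))
    (GRing.isLinear.Build _ _ _ _ _ rl).
  exists r; split=> [x|y]; first exact: (valP (s x)).
  by rewrite -[LHS]/(val (s (h y))) sK.
have /asboolP[[fl fJ] fu] := valP (s top : fiber).
have t2 : (val (s top : fiber)).2 = top := sK top.
move: fu; rewrite t2 path_top (xi_bas admI acyG Px0 lenU).
suff -> : (val (s top : fiber)).1 (rmul z P) = 0 by move=> /esym/eqP; rewrite oner_eq0.
pose d i : Q := [ffun j => if j == i then 1 else 0].
have -> : rmul z P = \sum_i rmul (d i) (z i * P).
  apply/ffunP => j; rewrite sum_ffunE (bigD1 j) //= !ffunE eqxx mul1r big1 ?addr0 //.
  by move=> i /negbTE ij; rewrite !ffunE eq_sym ij mul0r.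
rewrite klinear_sum // big1 // => i _.
have : (z i * P) *: s top = 0.
  rewrite -linearZ -scalerA path_top (radical_bas admI acyG Px0 lenU) ?linear0 //.
by move=> /(congr1 (fun x : fiber_mod => (val (x : fiber)).1 (d i))).
Qed.

(** With r the retraction onto JU, u - r(f, u) depends on f only and is A-linear
    in f.  Its last coordinate is a functional of f, hence of the finitely many
    values of f on a spanning list of Q, hence the evaluation at a combination
    z' of that list. *)
Lemma dual_witness : exists z' : Q, forall f, kfunctional f -> exists u : U,
  xi (P *: u) = f (rmul z P) /\ forall a, f (rmul z' a) = xi (a *: u).
Proof.
have [r [rrad rK]] := fiber_retraction.
have [s hs] := tuples_finite I m acyG.
pose psi (x : fiber) : U := (val x).2 - r x.
have psiP a (x y : fiber) : psi (fiber_act a x + y) = a *: psi x + psi y.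
  rewrite /psi -[r _]/(r (a *: (x : fiber_mod) + (y : fiber_mod))) linearP /= scalerBr.
  by rewrite opprD addrACA.
have psi0 (x : fiber) : (val x).1 = (fun=> 0) -> psi x = 0.
  move=> x0'; have /asboolP[_] := valP x; rewrite x0' => /esym/eqP.
  rewrite -(radicalE admI acyG Px0 lenU) => x2.
  suff -> : x = incl (Sub (val x).2 x2) by rewrite /psi rK subrr.
  by apply: val_inj; rewrite [LHS]surjective_pairing x0'.
pose W := {ffun 'I_(size s) -> K^o}.
pose coo (x : fiber) : W := [ffun i : 'I_(size s) => (val x).1 (s`_i)].
have cooP c (x y : fiber) : coo (fiber_act (sc c) x + y) = c *: coo x + coo y.
  apply/ffunP => i; rewrite !ffunE.
  by rewrite -[LHS]/((val (fiber_act (sc c) x)).1 (s`_i) + (val y).1 (s`_i)) precomp_scalar.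
have coo0 (x : fiber) : coo x = 0 -> (val x).1 = (fun=> 0).
  move=> cx; apply/funext => q; apply: (hs [set q | (val x).1 q = 0]) => [|y ys].
    have xl := fiber_klinear x.
    split=> [|c y y' /= hy hy']; first exact: klinear0.
    by rewrite xl hy hy' mulr0 addr0.
  have ym : (index y s < size s)%N by rewrite index_mem.
  by have /ffunP/(_ (Ordinal ym)) := cx; rewrite !ffunE /= nth_index.
have [|t _ tE] := @functional_extension K W [set y | exists x, y = (coo x, xi (psi x))].
  split.
  - have c0 : coo 0 = 0 by apply/ffunP => i; rewrite !ffunE.
    exists 0; rewrite c0; congr pair.
    by rewrite psi0 // (xi0 admI acyG Px0 lenU).
  - move=> c w a w' b [x [-> ->]] [y [-> ->]]; exists (fiber_act (sc c) x + y).
    by rewrite cooP psiP (xiP admI acyG Px0 lenU).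
  - by move=> a [x [/esym/coo0/psi0 x0' ->]]; rewrite x0' (xi0 admI acyG Px0 lenU).
pose d i : W := [ffun j => if j == i then 1 else 0].
pose z' : Q := \sum_(i < size s) (t (d i) : K) *: s`_i.
have z'E (x : fiber) : (val x).1 z' = xi (psi x).
  have <- : t (coo x) = xi (psi x) by apply: tE; exists x.
  have xl := fiber_klinear x.
  have -> : coo x = \sum_(i < size s) (val x).1 (s`_i) *: d i.
    apply/ffunP => j; rewrite sum_ffunE (bigD1 j) //= !ffunE eqxx big1 ?addr0.
      by rewrite -[RHS]/(_ * 1) mulr1.
    by move=> i /negbTE ij; rewrite !ffunE eq_sym ij scaler0.
  rewrite linear_sum klinear_sum //; apply: eq_bigr => i _.
  by rewrite klinearZ // linearZ /= mulrC.
exists z' => f kf.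
have xf : (f, sc (f (rmul z P)) *: top) \in fiber_pred.
  apply/asboolP; split=> //=; rewrite sc_scaleC path_top (xiZ admI acyG Px0 lenU).
  by rewrite (xi_bas admI acyG Px0 lenU) mulr1.
pose x : fiber := exist (fun y => y \in fiber_pred) (f, sc (f (rmul z P)) *: top) xf.
exists (psi x); split.
  rewrite scalerBr (xiD admI acyG Px0 lenU) (xiN admI acyG Px0 lenU).
  rewrite (path_xi_radical admI acyG Px0 lenU (rrad x)) (xi0 admI acyG Px0 lenU) subr0.
  by have /asboolP[_ <-] := xf.
move=> a; rewrite -[LHS]/((val (fiber_act a x)).1 z') z'E.
by rewrite -[fiber_act a x]addr0 psiP (psi0 0) // addr0.
Qed.

Lemma functional_separates q : (forall f, kfunctional f -> f q = 0) ->
  exists2 w, J w & q = rmul z (P * w).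
Proof.
move=> hq; have [|f fS|w [Jw ->]] := @separate K Q [set q | exists w, J w /\ q = rmul z (P * w)] q.
- have [J0 JP] := jacobson_subspace admI acyG.
  split; first by exists 0; split=> //; apply/ffunP => i; rewrite !ffunE !mulr0.
  move=> c x y [w [Jw ->]] [w' [Jw' ->]]; exists (c *: w + w'); split; first exact: JP.
  by rewrite mulrDr -qscaleAr rmulPr.
- apply: (hq (f : Q -> K)); split=> [c x y|w Jw]; first exact: linearP.
  by apply: fS; exists w.
- by exists w.
Qed.

(** Every equation is tested on the functionals f, where [dual_witness] turns it
    into a statement about the vector u of U.  This gives equalities modulo z P J,
    and z P J e_(v_i) = 0. *)
Lemma dual_tuple : exists z' : Q, [/\ rmul z' P = rmul z P,
  (forall g j, (j <= l)%N -> src g \notin pverts p ->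
     exists2 w, J w & rmul z' (F j * arrow_class I g) = rmul z (P * w)) &
  (forall d i j, (i <= l)%N -> (j <= l)%N -> src d = vt i -> tgt d = vt j ->
     exists k, rmul z' (F j * arrow_class I d) = k *: rmul z' (F i))].
Proof.
have [z' hz'] := dual_witness.
have Pzero w i : (i <= l)%N -> J w -> P * w * e (vt i) = 0.
  move=> il Jw; rewrite -path_r -!mulrA; have [|q [qs _ qe]] := @subpath_between G p 0 i.
    by rewrite il.
  by rewrite -qs -qe [_ * (w * _)]mulrA (reach_jacobson0 admI acyG) ?mulr0.
exists z'; split.
- have [f kf|w Jw hw] := @functional_separates (rmul z' P - rmul z P).
    have [u [uP ua]] := hz' f kf; have [fl _] := kf.
    by rewrite klinearB // ua uP subrr.
  have : rmul (rmul z' P - rmul z P) (e (vt 0)) = 0.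
    by rewrite hw rmulA Pzero //; apply/ffunP => i; rewrite !ffunE mulr0.
  move/ffunP=> h; apply/ffunP => i; have := h i; rewrite !ffunE mulrBl -!mulrA path_r.
  by move/eqP; rewrite subr_eq0 => /eqP.
- move=> g j jl gs; apply: functional_separates => f kf.
  have [u [_ ->]] := hz' f kf.
  rewrite -scalerA -[arrow_class I g](_ : arrow_class I g * e (src g) = _).
    by rewrite -scalerA (vertex_out admI acyG Px0 lenU) // !scaler0 (xi0 admI acyG Px0 lenU).
  by rewrite arrow_vertex eqxx.
move=> d i j il jl ds dt.
pose k := xi (F j *: (arrow_class I d *: bas i)); exists k.
have dE : arrow_class I d = arrow_class I d * e (vt i) by rewrite arrow_vertex ds eqxx.
have [f kf|w Jw hw] := @functional_separates (rmul z' (F j * arrow_class I d) - k *: rmul z' (F i)).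
  have [u [_ ua]] := hz' f kf; have [fl _] := kf.
  have -> : f (rmul z' (F j * arrow_class I d) - k *: rmul z' (F i)) =
      xi ((F j * arrow_class I d) *: u) - k * xi (F i *: u).
    by rewrite klinearB // klinearZ // !ua.
  have -> : (F j * arrow_class I d) *: u =
      sc (xi (F i *: u)) *: (F j *: (arrow_class I d *: bas i)).
    rewrite -scalerA {1}dE -[(arrow_class I d * _) *: u]scalerA.
    by rewrite (vertex_comp admI acyG Px0 lenU) // !sc_scaleC.
  by rewrite (xiZ admI acyG Px0 lenU) mulrC subrr.
have : rmul (rmul z' (F j * arrow_class I d) - k *: rmul z' (F i)) (e (vt i)) = 0.
  by rewrite hw rmulA Pzero //; apply/ffunP => i'; rewrite !ffunE mulr0.
move/ffunP=> h; apply/ffunP => i'; have := h i'; rewrite !ffunE mulrBl -qscaleAl.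
have -> : z' i' * (F j * arrow_class I d) * e (vt i) = z' i' * (F j * arrow_class I d).
  by rewrite -2!mulrA -dE.
by rewrite -[z' i' * F i * _]mulrA mfrom_r => /eqP; rewrite subr_eq0 => /eqP.
Qed.

End Necessity.

(** * The conditions in their literal form *)

Section Assembly.
Variables (K : fieldType) (G : quiver) (I : ideal (pathalg K G)).
Hypotheses (admI : admissible I) (acyG : acyclic_quiver G).
Variable (p : qpath G).
Local Notation A := (quotalg I).
Local Notation e v := (path_class I (vpath v)).
Local Notation P := (path_class I p).
Local Notation l := (plength p).
Local Notation vt := (vert p).
Local Notation F := (mfrom I p).
Local Notation T := (mto I p).
Local Notation J := (jacobson A).
Local Notation J2 := (ideal_exp (jacobson A) 2).
Local Notation sc := (@sc K G I).

(** If tgt g is the last vertex, [mast_from] is 1, but g absorbs the idempotent. *)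
Lemma mast_from_arrow (g : arrow G) j : (j <= l)%N -> tgt g = vt j ->
  mast_from I p (tgt g) * arrow_class I g = F j * arrow_class I g.
Proof.
move=> jl gj; rewrite gj; move: jl; rewrite leq_eqVlt => /orP[/eqP jl|jl]; last first.
  by rewrite mast_from_mfrom.
rewrite jl /mast_from index_vert // drop_size arrows_class_nil mul1r mfroml.
by rewrite vertex_arrow gj jl eqxx.
Qed.

Lemma mem_take_vert i : (i < l)%N -> vt i \in take l (pverts p).
Proof. by move=> il; rewrite in_take ?vert_mem ?index_vert // ltnW. Qed.

Lemma mem_behead_vert j : (0 < j <= l)%N -> vt j \in behead (pverts p).
Proof.
case: j => // j jl; rewrite -[vt j.+1]/(nth (pstart p) (behead (pverts p)) j).
by rewrite mem_nth // size_behead size_pverts.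
Qed.

Lemma take_vertP v : v \in take l (pverts p) -> exists2 i, (i < l)%N & v = vt i.
Proof.
move=> vt; have [i il vi] := vertP (mem_take vt); exists i => //.
by move: vt; rewrite vi in_take ?vert_mem // index_vert.
Qed.

Lemma behead_vertP v : v \in behead (pverts p) -> exists2 j, (0 < j <= l)%N & v = vt j.
Proof.
move=> vb; have [j jl vj] := vertP (mem_behead vb); exists j => //; rewrite jl andbT.
rewrite lt0n; apply/eqP => j0; have := pverts_uniq acyG p.
by rewrite /= -vert0 -j0 -vj vb.
Qed.

Lemma jacobson2_subspace : subspace J2.
Proof.
have [d0 dP] := deg_subspace I 2.
split=> [|c x y /(jacobson2E admI acyG) hx /(jacobson2E admI acyG) hy].
  exact/(jacobson2E admI acyG).
by apply/(jacobson2E admI acyG); apply: dP.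
Qed.

Section BasisModulo.
Variable R : seq A.
Hypothesis basis : basis_mod (mulset_r J P) (mulset_r J2 P) [seq r * P | r <- R].

(** A zero member of the family would contradict independence. *)
Lemma basis_neq0 r : r \in R -> r * P <> 0.
Proof.
move=> rR rP; have [_ _ indep] := basis.
have rm : (index r R < size [seq (r * P)%R | r <- R])%N by rewrite size_map index_mem.
suff S0 : mulset_r J2 P (\sum_(i < size [seq (r * P)%R | r <- R])
    ((i == Ordinal rm)%:R : K) *: [seq r * P | r <- R]`_i).
  by have /eqP := indep _ S0 (Ordinal rm); rewrite eqxx oner_eq0.
rewrite big1 => [|i _].
  by exists 0; [case: jacobson2_subspace|rewrite mul0r].
have [->|_] := eqVneq i (Ordinal rm); last by rewrite scale0r.
by rewrite (nth_map 0) /= ?index_mem // nth_index // rP scaler0.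
Qed.

Lemma arrows_deg s : deg (size s) (arrows_class I s).
Proof.
elim/last_ind: s => [|s g IH]; first by rewrite arrows_class_nil; exact: deg0.
rewrite size_rcons arrows_class_rcons -add1n; apply: degM => //; exact: deg_arrow.
Qed.

(** Descending induction on the degree: modulo J^2 P, an arrow times P is a
    combination of the r P, so an element of degree k times P v is an element of
    degree k + 1 times P v. *)
Lemma basis_generates (X : lmodType A) (v : X) :
  (forall r, r \in R -> r *: (P *: v) = 0) -> forall b, J b -> b *: (P *: v) = 0.
Proof.
move=> Rv b /(jacobsonE admI acyG); have [_ span _] := basis.
(* Here n bounds the number of steps until the degree forces x = 0. *)
suff H n : forall k x, (0 < k)%N -> (#|vertex G| <= n + k)%N -> deg k x -> x *: (P *: v) = 0.
  by apply: (H #|vertex G|) => //; exact: leq_addr.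
elim: n => [|n IH] k x k0 kn dx; first by rewrite (deg_nilp acyG _ dx) // scale0r.
apply: (dx [set x | x *: (P *: v) = 0]) => [|q kq /=].
  split=> [|c y y' /= hy hy']; first exact: scale0r.
  by rewrite scalerDl scE -scalerA hy hy' scaler0 addr0.
rewrite path_classE; move: kq; rewrite /plength.
case: (parrows q) => [|g s] /=; first by rewrite leqNgt k0.
move=> ks; rewrite arrows_class_cons -!scalerA.
have [->|eg] : e (pstart q) *: (P *: v) = 0 \/ e (pstart q) * P = P.
- by rewrite scalerA vertex_path; case: eqP => _; [right|left; rewrite scale0r].
- by rewrite !scaler0.
rewrite [e _ *: _]scalerA eg.
have [|c [j2 Jj2 jE]] := span (arrow_class I g * P).
  by exists (arrow_class I g) => //; apply/(jacobsonE admI acyG); exact: deg_arrow.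
have gP : arrow_class I g * P =
   j2 * P + \sum_(i < size [seq r * P | r <- R]) c i *: [seq r * P | r <- R]`_i.
  by rewrite jE subrK.
rewrite [arrow_class I g *: _]scalerA gP scalerDl scaler_suml big1 => [|i _]; last first.
  have ir : (i < size R)%N by apply: leq_trans (ltn_ord i) _; rewrite size_map.
  by rewrite (nth_map 0) // scE -!scalerA Rv ?scaler0 // mem_nth.
rewrite addr0 -scalerA scalerA; apply: (IH k.+1) => //; first by rewrite addnS.
have := degM (@arrows_deg s) (proj1 (jacobson2E admI acyG _) Jj2).
by apply: degS; rewrite addn2 ltnS.
Qed.

End BasisModulo.

(** The arrows that start at the end of the mast span J P modulo J^2 P. *)
Lemma radical_basis : exists bs : seq (arrow G),
  {subset bs <= [pred g | src g == vt l]} /\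
  basis_mod (mulset_r J P) (mulset_r J2 P) [seq arrow_class I g * P | g <- bs].
Proof.
have [J20 J2P] := jacobson2_subspace.
have sS : subspace (mulset_r J2 P).
  split; first by exists 0; rewrite ?mul0r.
  move=> c x y [a Ja <-] [b Jb <-]; exists (c *: a + b); first exact: J2P.
  by rewrite mulrDl -qscaleAl.
have [bs [bsr span indep]] := basis_extract (fun g => arrow_class I g * P)
  (enum [pred g | src g == vt l]) sS.
exists bs; split; first by move=> g /bsr; rewrite mem_enum.
split.
- move=> i; rewrite size_map => ib; exists (arrow_class I (tnth (in_tuple bs) (Ordinal ib))).
    by apply/(jacobsonE admI acyG); exact: deg_arrow.
  rewrite (nth_map (tnth (in_tuple bs) (Ordinal ib))) //.
  by congr (arrow_class I _ * P); exact: tnth_nth.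
- move=> _ [a /(jacobsonE admI acyG) da <-]; rewrite size_map.
  apply: (da [set a | exists c : 'I_(size bs) -> K, mulset_r J2 P
     (a * P - \sum_(i < size bs) c i *: [seq arrow_class I g * P | g <- bs]`_i)]).
    split.
      exists (fun=> 0); rewrite mul0r big1 ?subrr; first by case: sS.
      by move=> i _; rewrite scale0r.
    move=> c x y [d hd] [d' hd']; exists (fun i => c * d i + d' i).
    have -> : (c *: x + y) * P - \sum_(i < size bs)
        (c * d i + d' i) *: [seq arrow_class I g * P | g <- bs]`_i =
      c *: (x * P - \sum_(i < size bs) d i *: [seq arrow_class I g * P | g <- bs]`_i) +
      (y * P - \sum_(i < size bs) d' i *: [seq arrow_class I g * P | g <- bs]`_i).
      rewrite mulrDl -qscaleAl scalerBr addrACA -opprD scaler_sumr -big_split /=.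
      by congr (_ - _); apply: eq_bigr => i _; rewrite scalerDl scalerA.
    by case: sS => _; apply.
  move=> q; case: (ltnP 1 (plength q)) => q1 q0.
    exists (fun=> 0); rewrite big1 ?subr0 => [|i _]; last by rewrite scale0r.
    by exists (path_class I q) => //; apply/(jacobson2E admI acyG); exact: deg_path.
  have {q0 q1} : plength q = 1%N by apply/eqP; rewrite eqn_leq q1 q0.
  rewrite /plength; case qa: (parrows q) => [|g [|]] // _.
  have qg : q = apath g.
    apply: qpath_inj => //; have := valP q.
    rewrite -[(val q).1]/(pstart q) -[(val q).2]/(parrows q) qa /= andbT.
    by move=> /eqP/esym.
  have [gl|gl] := eqVneq (src g) (vt l).
    by rewrite qg; apply: span; rewrite mem_enum inE gl.
  exists (fun=> 0); rewrite big1 ?subr0 => [|i _]; last by rewrite scale0r.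
  have -> : path_class I q * P = 0; last by case: sS.
  rewrite qg -[path_class I (apath g)]/(arrow_class I g) -path_l mulrA arrow_vertex.
  by rewrite (negbTE gl) mul0r.
- move=> c; rewrite size_map in c *; exact: indep.
Qed.

Section Module.
Variables (U : lmodType A) (x0 : U).
Hypotheses (Px0 : P *: x0 <> 0) (lenU : module_length U l.+1).
Local Notation top := (top p x0).
Local Notation bas := (bas p x0).
Local Notation xi := (xi p x0).

Definition conditionA : Prop :=
  (forall b, arrowsB p b -> mulset_r J P (arrow_class I b * mast_to I p (src b))) /\
  (forall d, arrowsD p d ->
     Kline (mast_to I p (tgt d)) (arrow_class I d * mast_to I p (src d))).

Definition conditionB (R : seq A) : Prop :=
  [/\ forall r, r \in R -> J r,
      basis_mod (mulset_r J P) (mulset_r J2 P) [seq r * P | r <- R],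
      forall c, arrowsC p c -> exists2 w, mulset_l P J w &
        forall r, r \in R -> r * mast_from I p (tgt c) * arrow_class I c = r * w &
      forall d, arrowsD p d -> forall r, r \in R ->
        Kline (r * mast_from I p (src d)) (r * mast_from I p (tgt d) * arrow_class I d)].

Lemma conditionA_detour d i j : conditionA -> (i <= l)%N -> (j <= l)%N ->
  d \notin parrows p -> src d = vt i -> tgt d = vt j ->
  exists k, arrow_class I d * T i = sc k * T j.
Proof.
move=> [_ hD] il jl dp di dj; have ij := arrow_increasing acyG il jl di dj.
have [|k _ kE] := hD d; first by split=> //; rewrite ?di ?dj vert_mem.
exists k; rewrite -arrow_mast_to // -kE dj mast_to_mto ?scE // jl andbT.
exact: leq_ltn_trans ij.
Qed.

(** The right-hand side is closed under left multiplication by arrows: an arrow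
    out of v_i, i < l, belongs to the mast, to B or to D, and every arrow
    multiplies P into J P. *)
Lemma conditionA_corner : conditionA -> forall a, exists (c : 'I_l.+1 -> K) b,
  J b /\ a * e (vt 0) = \sum_i sc (c i) * T i + b * P.
Proof.
move=> hA; have [hB _] := hA.
pose S : set A := [set x | exists (c : 'I_l.+1 -> K) b, J b /\ x = \sum_i sc (c i) * T i + b * P].
have [J0 JP] := jacobson_subspace admI acyG.
have sS : subspace S.
  split.
    exists (fun=> 0), 0; split=> //.
    by rewrite big1 ?mul0r ?addr0 // => i _; rewrite sc0 mul0r.
  move=> k x y [c [b [Jb ->]]] [c' [b' [Jb' ->]]].
  exists (fun i => k * c i + c' i), (k *: b + b'); split; first exact: JP.
  rewrite scalerDr addrACA mulrDl -qscaleAl; congr (_ + _).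
  rewrite scaler_sumr -big_split /=; apply: eq_bigr => i _.
  by rewrite scD mulrDl scM scE mulrA.
have ST i : (i <= l)%N -> S (T i).
  move=> il; exists (fun j => (j == i :> nat)%:R), 0; split=> //.
  rewrite mul0r addr0 (bigD1 (Ordinal (n:=l.+1) il)) //= eqxx sc1 mul1r big1 ?addr0 // => j ji.
  rewrite -[(j == i :> nat)]/(j == Ordinal (n:=l.+1) il) (negbTE ji) sc0 mul0r //.
have SJ b : J b -> S (b * P).
  by move=> Jb; exists (fun=> 0), b; split=> //; rewrite big1 ?add0r // => i _; rewrite sc0 mul0r.
have SgT g i : (i <= l)%N -> S (arrow_class I g * T i).
  move=> il; have [gi|gi] := eqVneq (src g) (vt i); last first.
    by rewrite -mto_l // mulrA arrow_vertex (negbTE gi) mul0r; case: sS.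
  have Jg : J (arrow_class I g) by apply/(jacobsonE admI acyG); exact: deg_arrow.
  move: (il); rewrite leq_eqVlt => /orP[/eqP ->|il']; first by rewrite mtol; apply: SJ.
  have [/vertP[j jl gj]|gp] := boolP (tgt g \in pverts p); last first.
    have [|b Jb bE] := hB g; first by split=> //; rewrite gi mem_take_vert.
    by rewrite -arrow_mast_to // -bE; apply: SJ.
  have [gp|gp] := boolP (g \in parrows p); last first.
    have [k ->] := conditionA_detour hA il jl gp gi gj.
    by rewrite -scE; apply: subspaceZ => //; apply: ST.
  have [i' [i'l gi' _ gT _]] := mast_arrow I gp.
  have ei : i' = i by apply/eqP; rewrite -(vert_inj (p := p) acyG) // ?(ltnW i'l) // -gi' gi.
  by rewrite -ei -gT; apply: ST.
apply: (@alg_arrow_ind K G I [set a | S (a * e (vt 0))]).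
- split=> [|c x y hx hy] /=; first by rewrite mul0r; case: sS.
  by rewrite mulrDl -qscaleAl; case: sS => _; apply.
- move=> v /=; rewrite vertexM; case: eqP => _; last by case: sS.
  by rewrite -mto0; apply: ST.
move=> g x [c [b [Jb xE]]] /=; rewrite -mulrA xE mulrDr mulr_sumr.
apply: subspaceD => //; last by rewrite mulrA; apply: SJ; exact: jacobsonMl.
apply: subspace_sum => // i _; rewrite mulrA scC -mulrA -scE; apply: subspaceZ => //.
by apply: SgT; rewrite -ltnS.
Qed.

(** The scalars for d in D and the various r agree: for r F_j d = k' r F_i and
    d T_i = k T_j, multiplying by T_i and by r F_j gives k' r P = k r P, and r P
    is not zero. *)
Lemma conditions_sufficient R : conditionA -> conditionB R -> (0 < l)%N ->
  irreducible_map (radical_embedding U).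
Proof.
move=> hA [RJ Rb RC RD] l0.
apply: (radical_embedding_irreducible admI acyG Px0 lenU (conditionA_corner hA) l0 RJ).
- exact: basis_generates.
- move=> g j /[dup] j0l /andP[j0 jl] gs gj.
  have [|_ [w Jw <-] hw] := RC g; first by split=> //; rewrite gj mem_behead_vert.
  by exists w => // r /hw <-; rewrite -mulrA -(mast_from_arrow jl gj) mulrA.
move=> d i j il jl dp di dj; have [k kE] := conditionA_detour hA il jl dp di dj.
exists k => // r rR; have ij := arrow_increasing acyG il jl di dj.
have il' : (i < l)%N by exact: leq_trans jl.
have [|k' _ k'E] := RD d _ r rR; first by split=> //; rewrite ?di ?dj vert_mem.
have hF : r * F j * arrow_class I d = sc k' * (r * F i).
  by rewrite -mulrA -(mast_from_arrow jl dj) mulrA -k'E di mast_from_mfrom // scE.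
rewrite hF; congr (sc _ * _); apply/eqP; rewrite -subr_eq0; apply/eqP.
apply: (@sc_eq0 _ _ _ A^o _ (r * P)); last exact: basis_neq0 Rb _ rR.
rewrite scD scN scalerBl; apply/eqP; rewrite subr_eq0; apply/eqP.
rewrite -[LHS]/(sc k' * (r * P)) -[RHS]/(sc k * (r * P)).
have -> : sc k' * (r * P) = r * F j * arrow_class I d * T i.
  by rewrite hF -[sc k' * _ * _]mulrA -[r * F i * _]mulrA mfrom_mto.
rewrite -[r * F j * _ * _]mulrA kE -scE -qscaleAr -[r * F j * _]mulrA mfrom_mto //.
by rewrite scE.
Qed.

Hypothesis irr : irreducible_map (radical_embedding U).

(** If U is simple, then JU = 0 and the embedding splits. *)
Lemma irreducible_not_simple : ~ simple_module U.
Proof.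
move=> [_ /(_ [set u | u \in @rad_pred _ U])].
case=> [|radE|radE].
- split=> /= [|a x y hx hy]; first exact: rpred0.
  by rewrite rpredD ?rpredZ.
- have [ns _ _] := irr; apply: ns.
  have zl : linear (fun _ : U => 0 : radical_module U) by move=> a x y; rewrite scaler0 addr0.
  pose g : {linear U -> radical_module U} := HB.pack
    (fun _ : U => 0 : radical_module U) (GRing.isLinear.Build _ _ _ _ _ zl).
  exists g => y; apply: val_inj; rewrite [LHS](linear0 (radical_embedding U)).
  by have : [set u | u \in @rad_pred _ U] (val y) := valP y; rewrite radE => ->.
have : [set: U] top by []; rewrite -radE /=.
by rewrite (negbTE (top_not_radical admI acyG Px0 lenU)).
Qed.

Lemma length_gt0_irreducible : (0 < l)%N.
Proof.
rewrite lt0n; apply/eqP => l0; apply: irreducible_not_simple.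
exact: (simple_module_length0 admI acyG Px0 lenU l0).
Qed.

(** The products b T_i, and d T_i corrected by a multiple of T_j, kill the top,
    so [annihilator_top] puts them into A P; the idempotents at the target
    settle which element of A P they are. *)
Lemma irreducible_conditionA : conditionA.
Proof.
have l0 := length_gt0_irreducible.
split=> [b [/take_vertP[i il bi] bt]|d [/vertP[i il di] /vertP[j jl dj] dp]].
  rewrite bi in bt *; rewrite -bi (arrow_mast_to I acyG (ltnW il) bi).
  have [|c cE] := annihilator_top admI acyG Px0 lenU l0 irr (a := arrow_class I b * T i).
    have -> : arrow_class I b = e (tgt b) * arrow_class I b by rewrite vertex_arrow eqxx.
    by rewrite -!scalerA (vertex_out admI acyG Px0 lenU).
  exists (e (tgt b) * c * e (vt l)).
    by apply: (vertex_diff_jacobson admI acyG) => tl; move: bt; rewrite tl vert_mem.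
  by rewrite -mulrA path_l -mulrA -cE -mulrA mto_r mulrA vertex_arrow eqxx.
have ij := arrow_increasing acyG il jl di dj.
have j0 : (0 < j)%N by exact: leq_ltn_trans ij.
rewrite (arrow_mast_to I acyG il di) dj mast_to_mto ?j0 //.
pose k := xi (F j *: (arrow_class I d *: bas i)).
have dE : arrow_class I d = e (vt j) * arrow_class I d by rewrite vertex_arrow dj eqxx.
have [|c cE] := annihilator_top admI acyG Px0 lenU l0 irr
    (a := arrow_class I d * T i - sc k * T j).
  have -> : (arrow_class I d * T i - sc k * T j) *: top =
      arrow_class I d *: bas i - sc k *: bas j by rewrite scalerBl /bas !scalerA.
  rewrite dE -[(e _ * _) *: bas i]scalerA (vertex_comp admI acyG Px0 lenU) //.
  by rewrite -/k subrr.
have cP : exists k', e (vt j) * c * P = k' *: T j.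
  rewrite -(path_l I p) mulrA; have [jl'|jl'] := eqVneq j l.
    by exists (vcoef (vt l) c); rewrite jl' vertex_corner // -qscaleAl path_l mtol.
  exists 0; rewrite scale0r.
  have Jc : J (e (vt j) * c * e (vt l)).
    by apply: (vertex_diff_jacobson admI acyG); apply/eqP; rewrite vert_inj.
  have [|q [qs _ qe]] := @subpath_between G p j l; first by rewrite jl leqnn.
  have := reach_jacobson0 admI acyG q Jc; rewrite qs qe !mulrA vertex_idem.
  by rewrite -!mulrA vertex_idem !mulrA => ->; rewrite mul0r.
have [k' k'E] := cP; exists (k + k') => //.
have : e (vt j) * (arrow_class I d * T i - sc k * T j) = k' *: T j.
  rewrite -k'E -[_ * c * P]mulrA -cE; congr (_ * _).
  by rewrite mulrBl -[_ * T i * _]mulrA -[sc k * _ * _]mulrA !mto_r.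
rewrite mulrBr [e _ * (arrow_class I d * _)]mulrA -dE [e _ * (sc k * _)]mulrA scC.
rewrite -[sc k * _ * _]mulrA mto_l // => /eqP; rewrite subr_eq => /eqP ->.
by rewrite -scE -scalerDl addrC.
Qed.

(** R consists of the components of the tuple z' of [dual_tuple], cut on the left
    by the end of the corresponding arrow, which is not v_l, so that they lie in
    J, and on the right by the end of the mast. *)
Lemma irreducible_conditionB : exists R, conditionB R.
Proof.
have [bs [bsl bsb]] := radical_basis.
pose b (i : 'I_(size bs)) := tnth (in_tuple bs) i.
have bl i : src (b i) = vt l by apply/eqP; apply: (bsl (b i)); exact: mem_tnth.
pose z : {ffun 'I_(size bs) -> A} := [ffun i => arrow_class I (b i)].
have zJ i : J (z i) by rewrite ffunE; apply/(jacobsonE admI acyG); exact: deg_arrow.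
have [z' [z'P z'C z'D]] := dual_tuple admI acyG Px0 lenU zJ irr.
pose r i : A := e (tgt (b i)) * z' i * e (vt l).
have rP i : r i * P = arrow_class I (b i) * P.
  rewrite /r -mulrA path_l -mulrA; have /ffunP/(_ i) := z'P; rewrite !ffunE => ->.
  by rewrite mulrA vertex_arrow eqxx.
have rF i j a : (j <= l)%N -> r i * F j * a = e (tgt (b i)) * (z' i * (F j * a)).
  by move=> jl; rewrite /r -[_ * e (vt l) * F j]mulrA mfrom_l // -!mulrA.
have RP : [seq x * P | x <- [seq r i | i <- enum 'I_(size bs)]] =
    [seq arrow_class I g * P | g <- bs].
  rewrite -map_comp -[X in _ = map _ X](map_tnth_enum (in_tuple bs)) -map_comp.
  by apply: eq_map => i /=; rewrite rP.
exists [seq r i | i <- enum 'I_(size bs)]; split.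
- move=> _ /mapP[i _ ->]; apply: (vertex_diff_jacobson admI acyG) => tl.
  by have := arrow_increasing acyG (leqnn l) (leqnn l) (bl i) tl; rewrite ltnn.
- by rewrite RP.
- move=> g [gs /behead_vertP[j /andP[j0 jl] gj]].
  have [w Jw wE] := z'C g j jl gs; exists (P * w); first by exists w.
  move=> _ /mapP[i _ ->]; rewrite -mulrA (mast_from_arrow jl gj) mulrA rF //.
  have /ffunP/(_ i) := wE; rewrite !ffunE => ->.
  by rewrite [r i * _]mulrA rP !mulrA vertex_arrow eqxx.
move=> d [/vertP[i il di] /vertP[j jl dj] dp] _ /mapP[s _ ->].
have ij := arrow_increasing acyG il jl di dj.
have il' : (i < l)%N by exact: leq_trans jl.
have [k kE] := z'D d i j il jl di dj; exists k => //.
rewrite -mulrA (mast_from_arrow jl dj) mulrA rF // di mast_from_mfrom //.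
have /ffunP/(_ s) := kE; rewrite !ffunE => ->.
by rewrite -qscaleAr -[r s * F i]mulr1 rF // mulr1.
Qed.

End Module.
End Assembly.

Theorem mainTheorem2 (K : fieldType) (G : quiver) (I : ideal (pathalg K G))
    (admI : admissible I) (triangular : acyclic_quiver G)
    (U : lmodType (quotalg I)) (fgU : finitely_generated U)
    (uniU : uniserial U) (p : qpath G) (mastp : mast U p) :
  let J := jacobson (quotalg I) in
  let J2 := ideal_exp J 2 in
  let P := path_class I p in
  irreducible_map (radical_embedding U)
  <->
  (~ simple_module U /\
   ((forall b, arrowsB p b ->
       mulset_r J P (arrow_class I b * mast_to I p (src b))) /\
    (forall d, arrowsD p d ->
       Kline (mast_to I p (tgt d)) (arrow_class I d * mast_to I p (src d)))) /\
   exists R : seq (quotalg I),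
     [/\ forall r, r \in R -> J r,
         basis_mod (mulset_r J P) (mulset_r J2 P) [seq r * P | r <- R],
         forall c, arrowsC p c ->
           exists2 w, mulset_l P J w &
             forall r, r \in R ->
               r * mast_from I p (tgt c) * arrow_class I c = r * w &
         forall d, arrowsD p d -> forall r, r \in R ->
           Kline (r * mast_from I p (src d))
                 (r * mast_from I p (tgt d) * arrow_class I d)]).
Proof.
have [lenU [x0 Px0]] := mastp; move=> J J2 P; split=> [irr|[ns [hA [R hB]]]].
  split; first exact: (irreducible_not_simple admI triangular Px0 lenU irr).
  split; first exact: (irreducible_conditionA admI triangular Px0 lenU irr).
  exact: (irreducible_conditionB admI triangular Px0 lenU irr).
apply: (conditions_sufficient admI triangular Px0 lenU hA hB).
rewrite lt0n; apply/eqP => l0; apply: ns.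
exact: (simple_module_length0 admI triangular Px0 lenU l0).
Qed.
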